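(* Let $T>0$ and consider the problem $$u_t=\Delta u-c(x,t)u^p\ \ (x\in\Omega,\ t>0),\qquad \frac{\partial u(x,t)}{\partial\nu}=\int_{\Omega}k(x,y,t)u^l(y,t)\,dy\ \ (x\in\partial\Omega,\ t\ge0),\qquad u(x,0)=u_0(x)\ \ (x\in\Omega).$$ Assume that one of the following holds: (i) $l\ge 1$ and the problem has a solution in $Q_T$ (with nonnegative initial datum $u_0$); (ii) $l<1$, $p\ge 1$, the initial datum is positive, i.e. $u_0(x)>0$ for $x\in\overline\Omega$, and the problem has a solution in $Q_T$; (iii) $\max(p,l)<1$ and the problem has a solution in $Q_T$ which is positive in $Q_T\cup\Gamma_T$. Then the solution of the problem in $Q_T$ is unique.
   Context: Standing assumptions: $n\ge 1$, $\Omega\subset\mathbb{R}^n$ is a bounded domain with smooth boundary $\partial\Omega$, $\nu$ is the unit outward normal on $\partial\Omega$; $p>0$, $l>0$; $c\in C^{\alpha}_{loc}(\overline\Omega\times[0,+\infty))$ with $0<\alpha<1$ (locally Hölder continuous) and $c(x,t)\ge 0$; $k\in C(\partial\Omega\times\overline\Omega\times[0,+\infty))$, $k(x,y,t)\ge 0$; $u_0\in C^1(\overline\Omega)$, $u_0\ge 0$ in $\Omega$, and $\frac{\partial u_0(x)}{\partial\nu}=\int_\Omega k(x,y,0)u_0^l(y)\,dy$ on $\partial\Omega$. Notation: for $T>0$, $Q_T=\Omega\times(0,T)$, $S_T=\partial\Omega\times(0,T)$, $\Gamma_T=S_T\cup(\overline\Omega\times\{0\})$. Definition: a nonnegative function $u\in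 C^{2,1}(Q_T)\cap C^{1,0}(Q_T\cup\Gamma_T)$ is a solution of the problem in $Q_T$ if $u_t=\Delta u-c(x,t)u^p$ for $(x,t)\in Q_T$, $\frac{\partial u(x,t)}{\partial\nu}=\int_\Omega k(x,y,t)u^l(y,t)\,dy$ for $x\in\partial\Omega$, $0\le t<T$, and $u(x,0)=u_0(x)$ for $x\in\Omega$. *)

(* Defs.v *)
From HB Require Import structures.
From mathcomp Require Import all_boot all_order all_algebra.
From mathcomp Require Import all_classical all_reals all_analysis.
Set Implicit Arguments.
Unset Strict Implicit.
Unset Printing Implicit Defensive.
Import Order.TTheory GRing.Theory Num.Theory.
Import numFieldNormedType.Exports.
Local Open Scope classical_set_scope.
Local Open Scope ring_scope.

(* The library has no Lebesgue measure on R^n: it is built here on n-tuples as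
   the n-fold product of the Lebesgue measure on R. *)
Section lebesgue_measure_cons.
Variables (R : realType) (n : nat)
  (mu : {sigma_finite_measure set (n.-tuple (measurableTypeR R)) -> \bar R}).
Local Notation rT := (measurableTypeR R).

Definition consr (z : rT * n.-tuple rT) : n.+1.-tuple rT := [tuple of z.1 :: z.2].

Let measurable_consr : measurable_fun [set: rT * n.-tuple rT] consr.
Proof. exact: measurable_cons. Qed.

Definition lebesgue_measure_cons : set (n.+1.-tuple rT) -> \bar R :=
  pushforward (lebesgue_measure \x mu)%E consr.

Let cons0 : lebesgue_measure_cons set0 = 0%E.
Proof. by rewrite /lebesgue_measure_cons /pushforward preimage_set0 measure0. Qed.

Let cons_ge0 A : (0 <= lebesgue_measure_cons A)%E.
Proof. exact: measure_ge0. Qed.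

Let cons_sigma_additive : semi_sigma_additive lebesgue_measure_cons.
Proof.
pose M := measure_function_pushforward__canonical__measure_function_Measure
  ((@lebesgue_measure R) \x mu)%E measurable_consr.
exact: (@measure_semi_sigma_additive _ _ _ M).
Qed.

HB.instance Definition _ := isMeasure.Build _ _ _ lebesgue_measure_cons
  cons0 cons_ge0 cons_sigma_additive.

Let cons_sigma_finite : sigma_finite setT lebesgue_measure_cons.
Proof.
have /sigma_finiteP[F [FT ndF Foo]] := sigma_finiteT (@lebesgue_measure R).
have /sigma_finiteP[G [GT ndG Goo]] := sigma_finiteT mu.
exists (fun i => [set t : n.+1.-tuple rT | F i (thead t) /\ G i [tuple of behead t]]).
  rewrite predeqE => t; split=> // _.
  have [a _ Fa] : (\bigcup_i F i) (thead t) by rewrite -FT.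
  have [b _ Gb] : (\bigcup_i G i) [tuple of behead t] by rewrite -GT.
  exists (maxn a b) => //; split.
    by move: Fa; exact/subsetPset/ndF/leq_maxl.
  by move: Gb; exact/subsetPset/ndG/leq_maxr.
move=> i; have [mF Fi] := Foo i; have [mG Gi] := Goo i; split.
  apply: measurableI.
    by rewrite -[X in measurable X]setTI; exact: (measurable_tnth ord0).
  by rewrite -[X in measurable X]setTI; exact: measurable_behead.
rewrite /lebesgue_measure_cons /pushforward.
rewrite (_ : _ @^-1` _ = F i `*` G i) ?product_measure1E//.
  by rewrite lte_mul_pinfty// ge0_fin_numE.
apply/seteqP; split=> -[x t] /=; rewrite /consr/= theadE;
  by rewrite (_ : [tuple of _] = t)//; exact: val_inj.
Qed.

HB.instance Definition _ := Measure_isSigmaFinite.Build _ _ _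
  lebesgue_measure_cons cons_sigma_finite.

End lebesgue_measure_cons.

Fixpoint lebesgue_measure_tuple (R : realType) (n : nat) :
    {sigma_finite_measure set (n.-tuple (measurableTypeR R)) -> \bar R} :=
  match n with
  | 0 => dirac [tuple]
  | m.+1 => lebesgue_measure_cons (lebesgue_measure_tuple R m)
  end.

Section calculus.
Context {R : realType} {n : nat}.
Implicit Types (x v nu : 'rV[R]_n) (f phi : 'rV[R]_n -> R) (A U : set 'rV[R]_n).

Definition row_of_tuple (y : n.-tuple R) : 'rV[R]_n := \row_(i < n) tnth y i.

Definition integral_rV A f : R :=
  \int[lebesgue_measure_tuple R n]_(y in [set y | A (row_of_tuple y)])
    f (row_of_tuple y).

Definition boundary A : set 'rV[R]_n := closure A `\` interior A.

Definition basis_rV (i : 'I_n) : 'rV[R]_n := delta_mx 0 i.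

Definition partial (i : 'I_n) f x : R := 'D_(basis_rV i) f x.

Definition gradient f x : 'rV[R]_n := \row_(i < n) partial i f x.

(* The norm of 'rV[R]_n in the library is the sup norm. *)
Definition euclid_norm v : R := Num.sqrt (\sum_(i < n) v 0 i ^+ 2).

(* f is C^k on U, for U open *)
Fixpoint Ck_on (k : nat) U f : Prop :=
  (forall x, U x -> {for x, continuous f}) /\
  match k with
  | 0 => True
  | k'.+1 => forall i : 'I_n,
      (forall x, U x -> derivable f x (basis_rV i)) /\ Ck_on k' U (partial i f)
  end.

Definition smooth_on U f : Prop := forall k, Ck_on k U f.

Definition local_defining_function (Omega : set 'rV[R]_n) x U phi : Prop :=
  [/\ open U, U x, smooth_on U phi,
      forall y, U y -> gradient phi y != 0 &
      forall y, U y -> (Omega y <-> phi y < 0) /\ (boundary Omega y <-> phi y = 0)].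

Definition smooth_boundary (Omega : set 'rV[R]_n) : Prop :=
  forall x, boundary Omega x -> exists U phi, local_defining_function Omega x U phi.

Definition unit_outward_normal (Omega : set 'rV[R]_n) x nu : Prop :=
  exists U phi, local_defining_function Omega x U phi /\
    nu = (euclid_norm (gradient phi x))^-1 *: gradient phi x.

Definition bounded_smooth_domain (Omega : set 'rV[R]_n) : Prop :=
  [/\ open Omega, connected Omega, Omega !=set0, bounded_set Omega &
      smooth_boundary Omega].

(* C^1 up to the boundary: the partial derivatives extend continuously to
   closure Omega. *)
Definition C1_closure (Omega : set 'rV[R]_n) f : Prop :=
  {within closure Omega, continuous f} /\
  forall i : 'I_n,
    (forall x, Omega x -> derivable f x (basis_rV i)) /\
    exists g : 'rV[R]_n -> R, {within closure Omega, continuous g} /\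
      forall x, Omega x -> g x = partial i f x.

(* At a boundary point x, x - h *: nu lies in Omega for small h > 0; for f of
   class C^1 up to the boundary this limit is the scalar product of nu with the
   extended gradient. *)
Definition is_normal_derivative f x nu (l : R) : Prop :=
  h^-1 * (f x - f (x - h *: nu)) @[h --> 0^'+] --> l.

End calculus.

Section space_time.
Context {R : realType} {n : nat}.
Implicit Types (u w c : 'rV[R]_n -> R -> R) (D : set ('rV[R]_n * R)).
Implicit Types Omega : set 'rV[R]_n.

Definition partial_t u (x : 'rV[R]_n) (t : R) : R := derive1 (u x) t.

Definition partial_x (i : 'I_n) u (x : 'rV[R]_n) (t : R) : R := partial i (u ^~ t) x.

Definition laplacian u (x : 'rV[R]_n) (t : R) : R :=
  \sum_(i < n) partial_x i (partial_x i u) x t.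

Definition continuous_on D w : Prop :=
  {within D, continuous (fun z : 'rV[R]_n * R => w z.1 z.2)}.

Definition cylinder Omega (T : R) : set ('rV[R]_n * R) := Omega `*` `]0, T[.

(* Q_T together with Gamma_T, where
   Gamma_T = (boundary Omega x (0, T)) u (closure Omega x {0}) *)
Definition closed_cylinder Omega (T : R) : set ('rV[R]_n * R) :=
  cylinder Omega T `|` (boundary Omega `*` `]0, T[ `|` closure Omega `*` [set 0]).

Definition C21 D u : Prop :=
  [/\ continuous_on D u,
      (forall z, D z -> derivable (u z.1) z.2 1) /\ continuous_on D (partial_t u),
      forall i : 'I_n,
        (forall z, D z -> derivable (u ^~ z.2) z.1 (basis_rV i)) /\
        continuous_on D (partial_x i u) &
      forall i j : 'I_n,
        (forall z, D z -> derivable (partial_x i u ^~ z.2) z.1 (basis_rV j)) /\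
        continuous_on D (partial_x j (partial_x i u))].

(* u and its space derivatives are continuous up to the lateral boundary and
   the initial time *)
Definition C10_closed_cylinder Omega (T : R) u : Prop :=
  continuous_on (closed_cylinder Omega T) u /\
  forall i : 'I_n,
    (forall x t, Omega x -> 0 <= t < T -> derivable (u ^~ t) x (basis_rV i)) /\
    exists g : 'rV[R]_n -> R -> R, continuous_on (closed_cylinder Omega T) g /\
      forall x t, Omega x -> 0 <= t < T -> g x t = partial_x i u x t.

Definition loc_hoelder (alpha : R) D c : Prop :=
  forall K : set ('rV[R]_n * R), compact K -> K `<=` D ->
    exists L : R, forall z z', K z -> K z' ->
      `|c z.1 z.2 - c z'.1 z'.2| <= L * `|z - z'| `^ alpha.

Definition is_solution Omega (nu : 'rV[R]_n -> 'rV[R]_n) (p l : R) c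
    (k : 'rV[R]_n -> 'rV[R]_n -> R -> R) (u0 : 'rV[R]_n -> R) (T : R) u : Prop :=
  [/\ forall x t, closed_cylinder Omega T (x, t) -> 0 <= u x t,
      C21 (cylinder Omega T) u /\ C10_closed_cylinder Omega T u,
      forall x t, cylinder Omega T (x, t) ->
        partial_t u x t = laplacian u x t - c x t * u x t `^ p,
      forall x t, boundary Omega x -> 0 <= t < T ->
        is_normal_derivative (u ^~ t) x (nu x)
          (integral_rV Omega (fun y => k x y t * u y t `^ l)) &
      forall x, Omega x -> u x 0 = u0 x].

End space_time.

(* Main.v *)
Require Import Defs.
From mathcomp Require Import all_boot all_order all_algebra.
From mathcomp Require Import all_classical all_reals all_analysis.
From mathcomp Require Import ring lra.
From mathcomp Require Import measurable_realfun.
Import Order.TTheory GRing.Theory Num.Theory.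
Import numFieldNormedType.Exports.
Local Open Scope classical_set_scope.
Local Open Scope ring_scope.
Set Implicit Arguments.
Unset Strict Implicit.
Unset Printing Implicit Defensive.

(** Two solutions u and v are compared by a pointwise maximum principle applied
    to w = v - u.  Where w > 0 the absorption term only helps: c >= 0 and the
    power is nondecreasing, so w_t <= Delta w.  At the
    boundary the difference of the two nonlocal fluxes is at most a constant
    times max w, provided a ^ l - b ^ l <= C (a - b) for b <= a in the range of
    the solutions.  This holds with a uniform C when l >= 1 and the values are
    bounded, and also when l < 1 as soon as the larger value a stays above some
    d > 0: by concavity only a has to be kept away from 0, which is why
    positivity of a single solution is enough ([powR_sub_le]).

    The maximum principle [max_principle] has to absorb a flux of size
    K max w.  It compares w with m exp(lambda t) psi, where psi is bounded
    between 1/2 and 3 and has normal derivative larger than 3 K on the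
    boundary.  Such a psi is built only locally, near a boundary point x0, from
    a local defining function phi:
      psi = 1/2 + exp(2 M phi) / 2 + 4 |x - x0|^2 / r^2.
    As phi vanishes on the boundary and is negative inside, psi stays bounded
    while its normal derivative grows like M ([exists_barrier]).  Finitely many
    of these barriers, together with the constant barrier 3, are used: the
    largest value m of w exp(- lambda t) / psi over all of them is attained at
    some point, and the quadratic term forces that point inside the ball where
    the active barrier is smooth.  There the first and second order conditions
    for a maximum contradict either the differential inequality (lambda is
    larger than twice every Laplacian of a barrier) or the boundary inequality.

    When l < 1 <= p and u_0 > 0, the same principle applied to
    d exp(- lambda t) - u gives the lower bound on u ([sol_positive]): since
    p >= 1 the absorption c u ^ p is at most linear in u for bounded u. *)

(** * Integrals over bounded open sets *)

Lemma coord_le_norm (R : realType) n (x : 'rV[R]_n) (j : 'I_n) : `|x 0 j| <= `|x|.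
Proof.
rewrite [leRHS]/Num.norm /= mx_normrE.
exact: (@le_bigmax_cond _ _ _ 0 (ord0, j) predT (fun ij => `|x ij.1 ij.2|)).
Qed.

Lemma compact_continuous_bound (R : realType) (T : topologicalType) (A : set T) (f : T -> R) :
  compact A -> {within A, continuous f} ->
  exists2 M, 0 < M & forall x, A x -> `|f x| <= M.
Proof.
move=> cA cf; have /compact_bounded[M [_ bM]] := continuous_compact cf cA.
exists (`|M| + 1); first by rewrite ltr_wpDl.
move=> x Ax; apply: bM; last by exists x.
by rewrite (le_lt_trans (ler_norm M)) // ltrDl.
Qed.

Section measure.
Context {R : realType} {n : nat}.
Local Notation mu := (lebesgue_measure_tuple R n).
Local Notation tupleR := (n.-tuple (measurableTypeR R)).

Definition tuple_box (a b : 'I_n -> R) : set tupleR :=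
  [set y | forall j, a j <= tnth y j <= b j].

Lemma measurable_tuple_box (a b : 'I_n -> R) : measurable (tuple_box a b).
Proof.
rewrite (_ : tuple_box a b = \bigcap_(j in [set: 'I_n])
    ((@tnth n (measurableTypeR R))^~ j @^-1` `[a j, b j])).
  apply: fin_bigcap_measurable => //.
  move=> j _; rewrite -[X in measurable X]setTI.
  by apply: (measurable_tnth j) => //; exact: measurable_itv.
apply/seteqP; split => y /=.
  by move=> H j _ /=; rewrite in_itv /=; exact: H.
by move=> H j; have := H j I; rewrite /= in_itv.
Qed.

(** The sigma-algebra on tuples is generated by the coordinates; an open set is
    measurable because it is the countable union of the boxes with rational
    corners that it contains. *)
Lemma measurable_row_of_tuple_open (Omega : set 'rV[R]_n) : open Omega ->
  measurable [set y : tupleR | Omega (row_of_tuple y)].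
Proof.
move=> oO.
pose bx (q : n.-tuple rat * n.-tuple rat) : set tupleR :=
  tuple_box (fun j => ratr (tnth q.1 j)) (fun j => ratr (tnth q.2 j)).
pose F (q : n.-tuple rat * n.-tuple rat) : set tupleR :=
  if `[< bx q `<=` [set y : tupleR | Omega (row_of_tuple y)] >] then bx q else set0.
rewrite (_ : [set y | _] = \bigcup_q F q).
  apply: countable_bigcupT_measurable => //.
  move=> q; rewrite /F; case: asboolP => // _; exact: measurable_tuple_box.
apply/seteqP; split => [y|y].
  move=> /= Oy.
  have /nbhs_ballP [e /= e0 be] : nbhs (row_of_tuple y) Omega by apply: open_nbhs_nbhs.
  have ex1 (j : 'I_n) : {q : rat * rat |
      tnth y j - e < ratr q.1 < tnth y j /\ tnth y j < ratr q.2 < tnth y j + e}.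
    apply: cid.
    have [q1 ] := @rat_in_itvoo R (tnth y j - e) (tnth y j) ltac:(lra).
    have [q2 ] := @rat_in_itvoo R (tnth y j) (tnth y j + e) ltac:(lra).
    rewrite !in_itv /= => h2 h1; by exists (q1, q2).
  exists ([tuple (projT1 (ex1 j)).1 | j < n], [tuple (projT1 (ex1 j)).2 | j < n]) => //.
  rewrite /F; case: asboolP => [_|].
    move=> j /=; rewrite !tnth_mktuple.
    case: (ex1 j) => -[q1 q2] /= [/andP[_ h1] /andP[h2 _]].
    by rewrite !ltW.
  case => z hz /=; apply: be.
  rewrite /ball /= ; split => // i j; rewrite !mxE /= /ball /=.
  have := hz j; rewrite /= !tnth_mktuple.
  case: (ex1 j) => -[q1 q2] /= [/andP[h1 h2] /andP[h3 h4]] /andP[h5 h6].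
  rewrite ltr_distl; lra.
by case=> q _; rewrite /F; case: asboolP => // h; exact: h.
Qed.
End measure.

Lemma tuple_box_cons (R : realType) n (a b : R) :
  (fun z : measurableTypeR R * n.-tuple (measurableTypeR R) => consr z) @^-1`
    (tuple_box (fun=> a) (fun=> b)) = `[a, b] `*` (tuple_box (fun=> a) (fun=> b)).
Proof.
apply/seteqP; split => -[x t] /=.
  move=> H; split.
    by rewrite /= in_itv /=; have := H ord0.
  by move=> j; have := H (lift ord0 j); rewrite tnthS.
rewrite in_itv /=; case=> hx ht j.
have [i ->|->] := unliftP ord0 j; last by [].
by rewrite tnthS; exact: ht.
Qed.

Lemma tuple_box_lty (R : realType) n (a b : R) :
  (lebesgue_measure_tuple R n (tuple_box (fun=> a) (fun=> b)) < +oo)%E.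
Proof.
elim: n => [|n IH] /=.
  by rewrite diracE ltry.
rewrite /lebesgue_measure_cons /pushforward.
have := tuple_box_cons n a b.
rewrite /preimage => ->.
rewrite product_measure1E //; last exact: measurable_tuple_box.
have ab_fin : (@lebesgue_measure R `[a, b]%classic < +oo)%E.
  by rewrite lebesgue_measure_itv /=; case: ifP => _ //; rewrite -EFinB ltry.
by apply: lte_mul_pinfty => //; rewrite ge0_fin_numE.
Qed.

Lemma bounded_measure_lty (R : realType) n (Omega : set 'rV[R]_n) :
  open Omega -> bounded_set Omega ->
  (lebesgue_measure_tuple R n [set y | Omega (row_of_tuple y)] < +oo)%E.
Proof.
move=> oO [M [Mr bM]].
apply: (le_lt_trans _ (@tuple_box_lty R n (- (M + 1)) (M + 1))).
apply: le_measure; rewrite ?inE.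
- exact: measurable_row_of_tuple_open.
- exact: measurable_tuple_box.
move=> y /= Oy j; rewrite -ler_norml.
have := bM (M + 1) ltac:(by rewrite ltrDl) _ Oy; apply: le_trans.
by have := coord_le_norm (row_of_tuple y) j; rewrite mxE.
Qed.

Section integral_rV.
Context {R : realType} {n : nat}.
Variable Omega : set 'rV[R]_n.
Hypotheses (oO : open Omega) (bO : bounded_set Omega).
Local Notation D := [set y : n.-tuple (measurableTypeR R) | Omega (row_of_tuple y)].
Local Notation mu := (lebesgue_measure_tuple R n).

Definition volume : R := fine (mu D).

Let mD : measurable D.
Proof. exact: measurable_row_of_tuple_open. Qed.

Lemma measurable_fun_rV (f : 'rV[R]_n -> R) :
  {within closure Omega, continuous f} ->
  measurable_fun D (fun y => f (row_of_tuple y)).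
Proof.
move=> cf; apply: (measurability _ (RGenOpens.measurableE R)).
move=> _ [_ [a [b ->] <-]].
have cfO : {in Omega, continuous f}.
  rewrite -continuous_open_subspace //; apply: continuous_subspaceW cf; exact: subset_closure.
have oab : open (`]a, b[%classic : set R) by exact: interval_open.
have := (continuous_inP f oO).1 cfO _ oab.
exact: measurable_row_of_tuple_open.
Qed.

Lemma compact_closure_bounded : compact (closure Omega).
Proof.
apply: bounded_closed_compact; last exact: closed_closure.
case: bO => M [Mr bM]; exists M; split => // x xM y cy.
have : closed (closed_ball_ (fun z : 'rV[R]_n => `|z|) 0 x).
  exact: closed_closed_ball_.
move/closure_id => E.
have : closure Omega `<=` closed_ball_ (fun z : 'rV[R]_n => `|z|) 0 x.
  rewrite [X in _ `<=` X]E; apply: closureS => z Oz /=.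
  by rewrite /closed_ball_ /= sub0r normrN; exact: bM.
by move/(_ _ cy); rewrite /closed_ball_ /= sub0r normrN.
Qed.

(** Measurability and boundedness are used rather than continuity of
    [fun x => x `^ l], which fails at 0: this function is constantly 1 on the
    negative reals. *)
Lemma integrable_mul_powR (f g : 'rV[R]_n -> R) (l : R) : 0 <= l ->
  {within closure Omega, continuous f} ->
  {within closure Omega, continuous g} ->
  (forall x, closure Omega x -> 0 <= g x) ->
  mu.-integrable D (EFin \o (fun y => f (row_of_tuple y) * g (row_of_tuple y) `^ l)).
Proof.
move=> l0 cf cg g0; apply: measurable_bounded_integrable => //.
- exact: bounded_measure_lty.
- apply: measurable_funM; first exact: measurable_fun_rV.
  by apply: (measurableT_comp (measurable_powR _)); exact: measurable_fun_rV.
have [Mf Mf0 bf] := compact_continuous_bound compact_closure_bounded cf.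
have [Mg Mg0 bg] := compact_continuous_bound compact_closure_bounded cg.
exists (Mf * Mg `^ l); split; first exact: num_real.
move=> x hx y /= Oy.
apply: le_trans (ltW hx).
have cy : closure Omega (row_of_tuple y) by exact: subset_closure.
rewrite normrM ler_pM //; first exact: bf.
rewrite ger0_norm ?powR_ge0 // ge0_ler_powR // ?nnegrE ?g0 //; first exact: ltW.
by apply: le_trans (bg _ cy); exact: ler_norm.
Qed.

Lemma le_integral_rV (f g : 'rV[R]_n -> R) C :
  mu.-integrable D (EFin \o (fun y => f (row_of_tuple y))) ->
  mu.-integrable D (EFin \o (fun y => g (row_of_tuple y))) ->
  (forall y, Omega y -> f y - g y <= C) ->
  integral_rV Omega f - integral_rV Omega g <= C * volume.
Proof.
move=> cf cg fgC.
rewrite /integral_rV -RintegralB // -Rintegral_cst //.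
apply: le_Rintegral => //.
- have -> : EFin \o (fun x => f (row_of_tuple x) - g (row_of_tuple x)) =
   (fun x => (f (row_of_tuple x))%:E - (g (row_of_tuple x))%:E)%E by [].
  exact: integrableB.
- apply: measurable_bounded_integrable => //.
    exact: bounded_measure_lty.
  by exists `|C|; split => [|x hx y _ /=]; [exact: num_real|exact: ltW].
- by move=> y; exact: fgC.
Qed.
End integral_rV.

(** * Second derivatives of functions of one variable *)

Section one_dim.
Context {R : realType}.
Implicit Types (f g : R -> R) (x a b : R).

(** The first derivative is existentially quantified and constrained near x
    only: the restrictions of a solution to coordinate lines are differentiable
    just as long as the line stays inside the domain. *)
Definition deriv2_at f x b := exists f' : R -> R,
  (\forall s \near x, is_derive (s : R) 1 f (f' s)) /\ is_derive x 1 f' b.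

Lemma deriv2_atB f g x a b : deriv2_at f x a -> deriv2_at g x b ->
  deriv2_at (fun s => f s - g s) x (a - b).
Proof.
move=> [f' [nf f2]] [g' [ng g2]]; exists (fun s => f' s - g' s); split.
  near=> s.
  have h1 : is_derive (s : R) 1 f (f' s) by near: s.
  have h2 : is_derive (s : R) 1 g (g' s) by near: s.
  exact: is_deriveB.
exact: is_deriveB.
Unshelve. all: end_near. Qed.

Lemma deriv2_atD f g x a b : deriv2_at f x a -> deriv2_at g x b ->
  deriv2_at (fun s => f s + g s) x (a + b).
Proof.
move=> [f' [nf f2]] [g' [ng g2]]; exists (fun s => f' s + g' s); split.
  near=> s.
  have h1 : is_derive (s : R) 1 f (f' s) by near: s.
  have h2 : is_derive (s : R) 1 g (g' s) by near: s.
  exact: is_deriveD.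
exact: is_deriveD.
Unshelve. all: end_near. Qed.

Lemma deriv2_atZ f x a (c : R) : deriv2_at f x a ->
  deriv2_at (fun s => c * f s) x (c * a).
Proof.
move=> [f' [nf f2]]; exists (fun s => c * f' s); split.
  near=> s.
  have h1 : is_derive (s : R) 1 f (f' s) by near: s.
  exact: is_deriveZ.
exact: is_deriveZ.
Unshelve. all: end_near. Qed.

Lemma deriv2_at_cst (c : R) x : deriv2_at (fun=> c) x 0.
Proof.
exists (fun=> 0); split; first by near=> s; exact: is_derive_cst.
exact: is_derive_cst.
Unshelve. all: end_near. Qed.

Lemma is_derive_expRM f (c x a : R) : is_derive x 1 f a ->
  is_derive x 1 (fun s => expR (c * f s)) (c * a * expR (c * f x)).
Proof.
move=> fa; have h : is_derive x 1 (fun s => c * f s) (c * a) by exact: is_deriveZ.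
have := @is_derive1_comp _ expR (fun s => c * f s) x _ _ (is_derive_expR (c * f x)) h.
by rewrite mulrC.
Qed.

Lemma deriv2_at_expR f (c x a b : R) : is_derive x 1 f a -> deriv2_at f x b ->
  deriv2_at (fun s => expR (c * f s)) x ((c * b + (c * a) ^+ 2) * expR (c * f x)).
Proof.
move=> fa [f' [nf f2]].
have f'x : f' x = a.
  have h := nbhs_singleton nf.
  by rewrite -(@derive_val _ _ _ _ _ _ _ h) (@derive_val _ _ _ _ _ _ _ fa).
exists (fun s => c * f' s * expR (c * f s)); split.
  near=> s; apply: is_derive_expRM; near: s; exact: nf.
have h1 : is_derive x 1 (fun s => c * f' s) (c * b) by exact: is_deriveZ.
have h2 := is_derive_expRM c fa.
have h := is_deriveM h1 h2.
apply: is_derive_eq h _.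
rewrite /= /GRing.scale /= f'x; ring.
Unshelve. all: end_near. Qed.

(** Only the past of x is constrained, since a maximum over a time interval may
    be reached at the final time. *)
Lemma left_max_derive_ge0 f x a : is_derive x 1 f a ->
  (\forall s \near x, s <= x -> f s <= f x) -> 0 <= a.
Proof.
move=> [df <-] nmax.
have cv : h^-1 *: (f (h *: 1 + x) - f x) @[h --> 0^'] --> 'D_1 f x by exact: df.
have /nbhs_ballP[e /= e0 be] := nmax.
have cvl := cvg_dnbhs_at_left cv.
apply: (cvgr_to_ge cvl).
near=> h.
have h0 : h < 0 by near: h; exact: nbhs_left_lt.
have he : - e < h by near: h; apply: nbhs_left_gt; rewrite oppr_lt0.
have : f (h *: 1 + x) - f x <= 0.
  rewrite subr_le0 /GRing.scale /= mulr1; apply: be; last by lra.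
  by rewrite /ball /= ltr_distl; lra.
by rewrite /GRing.scale /=; apply: mulr_le0; rewrite invr_le0 ltW.
Unshelve. all: end_near. Qed.

(** If b > 0 then f', which vanishes at x, is positive just to the right of x,
    and the mean value theorem gives values of f larger than f x. *)
Lemma local_max_deriv2_le0 f x b : deriv2_at f x b ->
  (\forall s \near x, f s <= f x) -> b <= 0.
Proof.
move=> [f' [/nbhs_ballP[e /= e0 be] f2]] /nbhs_ballP[e1 /= e10 be1].
rewrite leNgt; apply/negP => b0.
pose r := Num.min e e1.
have r0 : 0 < r by rewrite lt_min e0.
have re : r <= e by rewrite ge_min lexx.
have re1 : r <= e1 by rewrite ge_min lexx orbT.
have inr s : x - r < s < x + r -> is_derive (s : R) 1 f (f' s) /\ f s <= f x.
  move=> hs; split.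
    by apply: be; rewrite /ball /= distrC ltr_distl; lra.
  by apply: be1; rewrite /ball /= distrC ltr_distl; lra.
have f'x : f' x = 0.
  have [h1 _] := inr x ltac:(lra).
  have h2 : is_derive x 1 f 0.
    apply: (@derive1_at_max _ f (x - r) (x + r)); first by lra.
    - move=> t; rewrite in_itv /= => ht; have [h _] := inr t ht; exact: (@ex_derive _ _ _ _ _ _ _ h).
    - by rewrite in_itv /=; lra.
    - by move=> t; rewrite in_itv /= => ht; have [] := inr t ht.
  by rewrite -(@derive_val _ _ _ _ _ _ _ h1) (@derive_val _ _ _ _ _ _ _ h2).
have cv : h^-1 *: (f' (h *: 1 + x) - f' x) @[h --> 0^'] --> b.
  by case: f2 => df <-; exact: df.
have cvr := cvg_dnbhs_at_right cv.
have := cvgr_gt _ cvr _ b0.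
move=> [d /= d0 hd].
pose h : R := Num.min d r / 2.
have m0 : 0 < Num.min d r by rewrite lt_min d0.
have hh : 0 < h by rewrite divr_gt0.
have mr : Num.min d r <= r by rewrite ge_min lexx orbT.
have md : Num.min d r <= d by rewrite ge_min lexx.
have hltr : h < r by rewrite /h; lra.
have hltd : h < d by rewrite /h; lra.
have [|s||y] := @MVT _ f f' x (x + h).
- by rewrite ltrDl.
- by rewrite in_itv /= => hs; have [] := inr s ltac:(lra).
- apply: continuous_in_subspaceT => z; rewrite inE /= in_itv /= => hz.
  have [dz _] := inr z ltac:(lra).
  by apply: differentiable_continuous; apply/derivable1_diffP; exact: (@ex_derive _ _ _ _ _ _ _ dz).
rewrite in_itv /= => hy eqf.
have f'y : 0 < f' y.
  have := hd (y - x); rewrite /ball_ /= sub0r normrN gtr0_norm; last by lra.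
  move=> /(_ ltac:(lra) ltac:(lra)).
  rewrite /GRing.scale /= mulr1 subrK f'x subr0 pmulr_rgt0 // invr_gt0; lra.
have [_] := inr (x + h) ltac:(lra).
rewrite -subr_le0 eqf addrAC subrr add0r leNgt => /negP; apply.
exact: mulr_gt0.
Qed.
End one_dim.

(** * Directional derivatives of functions of class C^1 *)

Section multi.
Context {R : realType} {n : nat}.
Implicit Types (x v w : 'rV[R]_n) (f : 'rV[R]_n -> R).

Lemma line_is_derive f x v (s d : R) : is_derive (x + s *: v) v f d ->
  is_derive s 1 (fun s => f (x + s *: v)) d.
Proof.
have E : (fun h : R => h^-1 *: (f (h *: v + (x + s *: v)) - f (x + s *: v))) =
         (fun h : R => h^-1 *: (f (x + (h *: 1 + s) *: v) - f (x + s *: v))).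
  apply/funext => h; congr (_ *: (f _ - _)).
  by rewrite [h *: 1]mulr1 scalerDl addrCA.
case=> df dv; apply: DeriveDef.
  by move: df; rewrite /derivable /= E.
by move: dv; rewrite /derive /= E.
Qed.

Lemma is_derive_line f x v (s d : R) : is_derive s 1 (fun s => f (x + s *: v)) d ->
  is_derive (x + s *: v) v f d.
Proof.
have E : (fun h : R => h^-1 *: (f (h *: v + (x + s *: v)) - f (x + s *: v))) =
         (fun h : R => h^-1 *: (f (x + (h *: 1 + s) *: v) - f (x + s *: v))).
  apply/funext => h; congr (_ *: (f _ - _)).
  by rewrite [h *: 1]mulr1 scalerDl addrCA.
case=> df dv; apply: DeriveDef.
  by move: df; rewrite /derivable /= E.
by move: dv; rewrite /derive /= E.
Qed.

(** The corners of the path from x to x + w that moves one coordinate at a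
    time. *)
Let pt x w (k : nat) : 'rV[R]_n :=
  \row_j (if (j < k)%N then x 0 j + w 0 j else x 0 j).

Lemma norm_lt_coord x (e : R) : 0 < e -> (forall i, `|x 0 i| < e) -> `|x| < e.
Proof.
move=> e0 H; rewrite [ltLHS]/Num.norm /= mx_normrE.
apply: bigmax_lt => // -[i j] _ /=; rewrite ord1; exact: H.
Qed.

(** The increment telescopes along the axis-parallel path from x to x + w; on
    each edge the mean value theorem replaces it by a value of a partial
    derivative close to x. *)
Lemma C1_increment f x (e : R) : 0 < e ->
  (forall i, \forall y \near x, derivable f y (basis_rV i)) ->
  (forall i, {for x, continuous (partial i f)}) ->
  exists2 d : R, 0 < d & forall w, `|w| < d ->
    `|f (x + w) - f x - \sum_(i < n) w 0 i * partial i f x| <=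
    e * \sum_(i < n) `|w 0 i|.
Proof.
move=> e0 df cf.
have : \forall y \near x, forall i, derivable f y (basis_rV i) /\
    `|partial i f x - partial i f y| < e.
  apply: (@filter_forall _ _ (fun i => [set y | derivable f y (basis_rV i) /\
    `|partial i f x - partial i f y| < e]) _ (nbhs_filter x)) => i; apply: filterI; first exact: df.
  have /cvgr_dist_lt := cf i; exact.
move=> /nbhs_ballP[d /= d0 bd]; exists d => // w wd.
have bd' y : `|y - x| < d -> forall i, derivable f y (basis_rV i) /\
    `|partial i f x - partial i f y| < e.
  by move=> yx; apply: bd; rewrite -ball_normE /= distrC.
suff H k : (k <= n)%N -> `|f (pt x w k) - f x - \sum_(i < n | (i < k)%N) w 0 i * partial i f x| <=
    e * \sum_(i < n | (i < k)%N) `|w 0 i|.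
  have := H n (leqnn n).
  have -> : pt x w n = x + w by apply/rowP => j; rewrite !mxE ltn_ord.
  have sT (F : 'I_n -> R) : \sum_(i < n | (i < n)%N) F i = \sum_(i < n) F i.
    by apply: eq_bigl => i; rewrite ltn_ord.
  by rewrite !sT.
elim: k => [_|k IH kn].
  have -> : pt x w 0 = x by apply/rowP => j; rewrite !mxE.
  by rewrite !big_pred0 // subrr subr0 normr0 mulr0.
pose i0 := Ordinal kn.
have sumS (F : 'I_n -> R) : \sum_(i < n | (i < k.+1)%N) F i = F i0 + \sum_(i < n | (i < k)%N) F i.
  rewrite (bigD1 i0) //=; congr (_ + _); apply: eq_bigl => i.
  by rewrite ltnS leq_eqVlt -(inj_eq val_inj) /=; case: ltngtP.
have ptS : pt x w k.+1 = pt x w k + w 0 i0 *: basis_rV i0.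
  apply/rowP => j; rewrite !mxE eqxx /= ltnS leq_eqVlt -(inj_eq val_inj) /=.
  have [jk|jk] := eqVneq (j : nat) k.
    have -> : i0 = j by apply: val_inj.
    by rewrite jk ltnn mulr1.
  by rewrite /= mulr0 addr0.
pose g s := f (pt x w k + (s * w 0 i0) *: basis_rV i0).
pose g' s := w 0 i0 * partial i0 f (pt x w k + (s * w 0 i0) *: basis_rV i0).
have inb (s : R) : 0 <= s <= 1 -> `|pt x w k + (s * w 0 i0) *: basis_rV i0 - x| < d.
  move=> s01; apply: norm_lt_coord => // j.
  have wj : `|w 0 j| < d by apply: le_lt_trans wd; exact: coord_le_norm.
  rewrite !mxE eqxx /= -(inj_eq val_inj) /=.
  have [jk|jk] := eqVneq (j : nat) k.
    have -> : i0 = j by apply: val_inj.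
    rewrite jk ltnn mulr1 addrAC subrr add0r normrM.
    apply: le_lt_trans wj; apply: ler_piMl => //; rewrite ger0_norm; lra.
  rewrite mulr0 addr0; case: ifP => _; first by rewrite addrAC subrr add0r.
  by rewrite subrr normr0.
have dg s : 0 <= s <= 1 -> is_derive (s : R) 1 g (g' s).
  move=> s01; have [dfy _] := bd' _ (inb s s01) i0.
  have h1 : is_derive (s * w 0 i0) 1 (fun r => f (pt x w k + r *: basis_rV i0))
      (partial i0 f (pt x w k + (s * w 0 i0) *: basis_rV i0)).
    by apply: line_is_derive; exact: derivableP.
  have h2 : is_derive (s : R) 1 (fun s => s * w 0 i0) (w 0 i0).
    have h := @is_derive_id _ _ s 1.
    have := is_deriveM h (is_derive_cst (w 0 i0) s 1).
    move=> h'; apply: is_derive_eq h' _; rewrite /= /GRing.scale /=; ring.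
  have := @is_derive1_comp _ (fun r => f (pt x w k + r *: basis_rV i0)) _ s _ _ h1 h2.
  by rewrite mulrC.
have [s|s|] := @MVT_segment _ g g' 0 1 ler01.
- by rewrite in_itv /= => hs; apply: dg; lra.
- apply: continuous_in_subspaceT => z; rewrite inE /= in_itv /= => hz.
  have dz := dg z hz.
  by apply: differentiable_continuous; apply/derivable1_diffP; exact: (@ex_derive _ _ _ _ _ _ _ dz).
move=> s; rewrite in_itv /= => hs; rewrite /g mul1r mul0r scale0r addr0 -ptS subr0 mulr1 => E.
rewrite !sumS.
have -> : f (pt x w k.+1) - f x -
    (w 0 i0 * partial i0 f x + \sum_(i < n | (i < k)%N) w 0 i * partial i f x)
  = (f (pt x w k.+1) - f (pt x w k) - w 0 i0 * partial i0 f x) + 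
    (f (pt x w k) - f x - \sum_(i < n | (i < k)%N) w 0 i * partial i f x) by ring.
rewrite mulrDr; apply: (le_trans (ler_normD _ _)); apply: lerD; last exact: (IH (ltnW kn)).
rewrite E /g' -mulrBr normrM mulrC distrC; apply: ler_wpM2r => //.
have [_ /ltW] := bd' _ (inb s hs) i0; exact.
Qed.

End multi.

Section directional.
Context {R : realType} {n : nat}.
Implicit Types (x v w : 'rV[R]_n) (f : 'rV[R]_n -> R).

Definition dot v w : R := \sum_(i < n) v 0 i * w 0 i.

Lemma dotDl u v w : dot (u + v) w = dot u w + dot v w.
Proof. by rewrite /dot -big_split /=; apply: eq_bigr => i _; rewrite mxE mulrDl. Qed.

Lemma dotZl (c : R) v w : dot (c *: v) w = c * dot v w.
Proof. by rewrite /dot mulr_sumr; apply: eq_bigr => i _; rewrite mxE mulrA. Qed.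

Lemma dotC v w : dot v w = dot w v.
Proof. by rewrite /dot; apply: eq_bigr => i _; rewrite mulrC. Qed.

Lemma dot_gt0 v : v != 0 -> 0 < dot v v.
Proof.
move=> v0; rewrite lt_def sumr_ge0 ?andbT; last by move=> i _; rewrite -expr2 sqr_ge0.
apply: contra v0 => /eqP H; apply/eqP/rowP => i; rewrite mxE.
have : v 0 i * v 0 i = 0.
  have /eqP := H; rewrite psumr_eq0; last by move=> j _; rewrite -expr2 sqr_ge0.
  by move=> /allP /(_ i (mem_index_enum _)) /= /eqP.
by move/eqP; rewrite mulf_eq0 orbb => /eqP.
Qed.

Lemma euclid_normE v : euclid_norm v = Num.sqrt (dot v v).
Proof. by congr Num.sqrt; apply: eq_bigr => i _; rewrite expr2. Qed.

Lemma is_derive_cvg f x v (a : R) :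
  h^-1 * (f (x + h *: v) - f x) @[h --> 0^'] --> a -> is_derive x v f a.
Proof.
have -> : (fun h : R => h^-1 * (f (x + h *: v) - f x)) = (fun h => h^-1 *: (f (h *: v + x) - f x)).
  by apply/funext => h; rewrite [x + _]addrC.
move=> cv; apply: DeriveDef; first exact: cvgP cv.
exact: cvg_lim cv.
Qed.

Lemma is_derive_cvgE f x v (a : R) : is_derive x v f a ->
  h^-1 * (f (x + h *: v) - f x) @[h --> 0^'] --> a.
Proof.
have -> : (fun h : R => h^-1 * (f (x + h *: v) - f x)) = (fun h => h^-1 *: (f (h *: v + x) - f x)).
  by apply/funext => h; rewrite [x + _]addrC.
by case=> df <-; exact: df.
Qed.

Lemma C1_is_derive f x v :
  (forall i, \forall y \near x, derivable f y (basis_rV i)) ->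
  (forall i, {for x, continuous (partial i f)}) ->
  is_derive x v f (dot v (gradient f x)).
Proof.
move=> df cf; apply: is_derive_cvg; apply/cvgrPdist_le => e e0.
pose S := \sum_(i < n) `|v 0 i|.
have S0 : 0 <= S by apply: sumr_ge0.
have e'0 : 0 < e / (S + 1) by rewrite divr_gt0 // ltr_wpDl.
have [d d0 H] := C1_increment e'0 df cf.
near=> h.
have h0 : h != 0 by near: h; exact: nbhs_dnbhs_neq.
have hd : `|h *: v| < d.
  rewrite normrZ.
  have : `|h| < d / (`|v| + 1).
    near: h; apply: dnbhs0_lt; rewrite divr_gt0 // ltr_wpDl //.
  rewrite ltr_pdivlMr ?ltr_wpDl // => hv; apply: le_lt_trans hv.
  by rewrite ler_wpM2l // lerDl.
have := H _ hd.
have -> : \sum_(i < n) (h *: v) 0 i * partial i f x = h * dot v (gradient f x).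
  by rewrite /dot mulr_sumr; apply: eq_bigr => i _; rewrite !mxE mulrA.
have -> : \sum_(i < n) `|(h *: v) 0 i| = `|h| * S.
  by rewrite /S mulr_sumr; apply: eq_bigr => i _; rewrite !mxE normrM.
move=> hh.
have -> : dot v (gradient f x) - h^-1 * (f (x + h *: v) - f x) =
  - (h^-1 * (f (x + h *: v) - f x - h * dot v (gradient f x))).
  by field.
rewrite normrN normrM normfV ler_pdivrMl ?normr_gt0 //.
apply: le_trans hh _.
rewrite mulrCA; apply: ler_wpM2l => //.
rewrite mulrAC ler_pdivrMr ?ltr_wpDl //.
by rewrite ler_pM2l // lerDl.
Unshelve. all: end_near. Qed.

Lemma smooth_on_derivable U f i : smooth_on U f ->
  forall x, U x -> derivable f x (basis_rV i).
Proof. by move=> sm; have [_ /(_ i) []] := sm 1%N. Qed.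

Lemma smooth_on_continuous U f : smooth_on U f ->
  forall x, U x -> {for x, continuous f}.
Proof. by move=> sm; have [] := sm 0%N. Qed.

Lemma smooth_on_partial U f i : smooth_on U f -> smooth_on U (partial i f).
Proof. by move=> sm k; have [_ /(_ i) []] := sm k.+1. Qed.

Lemma smooth_on_is_derive U f x v : open U -> smooth_on U f -> U x ->
  is_derive x v f (dot v (gradient f x)).
Proof.
move=> oU sm Ux; apply: C1_is_derive => i.
  have : \forall y \near x, U y by apply: open_nbhs_nbhs.
  apply: filterS; exact: smooth_on_derivable.
exact: smooth_on_continuous (smooth_on_partial i sm) _ Ux.
Qed.

Lemma derive_lt0_near f x v (a : R) : is_derive x v f a -> a < 0 ->
  \forall h \near 0^'+, f (x + h *: v) < f x.
Proof.
move=> /is_derive_cvgE /cvg_dnbhs_at_right cv a0.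
near=> h.
have h0 : 0 < h by near: h; exact: nbhs_right_gt.
have : h^-1 * (f (x + h *: v) - f x) < 0.
  near: h; exact: (cvgr_lt _ cv).
by rewrite pmulr_rlt0 ?invr_gt0 // subr_lt0.
Unshelve. all: end_near. Qed.

Lemma derive_le0_near f x v (a : R) : is_derive x v f a ->
  (\forall h \near 0^'+, f (x + h *: v) < f x) -> a <= 0.
Proof.
move=> /is_derive_cvgE /cvg_dnbhs_at_right cv nf.
apply: (cvgr_to_le cv); near=> h.
have h0 : 0 < h by near: h; exact: nbhs_right_gt.
rewrite pmulr_rle0 ?invr_gt0 // subr_le0; apply: ltW; near: h; exact: nf.
Unshelve. all: end_near. Qed.

Lemma near0_right (P : set R) : (\forall h \near (0 : R), P h) -> \forall h \near 0^'+, P h.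
Proof. exact: cvg_within. Qed.

Lemma near_line U x v : nbhs x U -> \forall h \near (0 : R), U (x + h *: v).
Proof.
move=> nU.
have : (fun h : R => x + h *: v) @ (0 : R) --> x + 0 *: v.
  by apply: cvgD; [exact: cvg_cst | apply: cvgZr_tmp; exact: cvg_id].
by rewrite scale0r addr0; apply.
Qed.

(** * The outward normal and local defining functions *)

Section normal.
Variables (Omega : set 'rV[R]_n) (x nu : 'rV[R]_n).
Hypothesis bx : boundary Omega x.
Hypothesis hnu : unit_outward_normal Omega x nu.

Lemma defining_fun0 x' U phi : local_defining_function Omega x' U phi -> U x -> phi x = 0.
Proof. by case=> _ _ _ _ H Ux; have [_ [/(_ bx)]] := H x Ux. Qed.

Lemma normal_inward : \forall h \near 0^'+, Omega (x - h *: nu).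
Proof.
have [U [phi [ld nuE]]] := hnu.
have [oU Ux sm g0 H] := ld.
have Gg := dot_gt0 (g0 _ Ux).
have D := smooth_on_is_derive (- nu) oU sm Ux.
have neg : dot (- nu) (gradient phi x) < 0.
  rewrite -scaleN1r dotZl mulN1r oppr_lt0 nuE dotZl mulr_gt0 // invr_gt0 /euclid_norm sqrtr_gt0.
  by under eq_bigr do rewrite expr2.
have nr := derive_lt0_near D neg.
have nU : \forall h \near (0 : R), U (x + h *: - nu).
  by apply: near_line; exact: open_nbhs_nbhs.
near=> h.
rewrite -scalerN; apply/(H _ _).1.
  by near: h; exact: near0_right.
rewrite -(defining_fun0 ld Ux); near: h; exact: nr.
Unshelve. all: end_near. Qed.

(** This says that nu is the normalised gradient of every local defining
    function phi, not only of the function phi' that witnesses [hnu].  A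
    direction d with d . grad phi' < 0 enters Omega, so d . grad phi <= 0; the
    directions d = A grad phi - (B + e) grad phi' below give A C <= (B + e) B,
    where A and C are the squared norms of the two gradients and B is their
    scalar product.  Hence B > 0 and A C <= B ^ 2. *)
Lemma normal_dot_gradient x' U phi : local_defining_function Omega x' U phi -> U x ->
  Num.sqrt (dot (gradient phi x) (gradient phi x)) <= dot nu (gradient phi x).
Proof.
move=> ld Ux; have [oU _ sm g0 H] := ld.
have [U' [phi' [ld' nuE]]] := hnu.
have [oU' Ux' sm' g0' H'] := ld'.
set G := gradient phi x; set G' := gradient phi' x in nuE.
have A0 : 0 < dot G' G' by apply: dot_gt0; exact: g0'.
have C0 : 0 < dot G G by apply: dot_gt0; exact: g0.
have key d : dot d G' < 0 -> dot d G <= 0.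
  move=> dG'; apply: (derive_le0_near (smooth_on_is_derive d oU sm Ux)).
  have nr := derive_lt0_near (smooth_on_is_derive d oU' sm' Ux') dG'.
  have nU : \forall h \near (0 : R), U (x + h *: d).
    by apply: near_line; exact: open_nbhs_nbhs.
  have nU' : \forall h \near (0 : R), U' (x + h *: d).
    by apply: near_line; exact: open_nbhs_nbhs.
  near=> h.
  rewrite (defining_fun0 ld Ux); apply/(H _ _).1.
    by near: h; exact: near0_right.
  apply/(H' _ _).1.
    by near: h; exact: near0_right.
  rewrite -(defining_fun0 ld' Ux'); near: h; exact: nr.
set A := dot G' G' in A0; set C := dot G G in C0 *; pose B := dot G' G.
have key2 (e : R) : 0 < e -> A * C <= (B + e) * B.
  move=> e0; have := key (A *: G - (B + e) *: G').
  rewrite -scaleNr !dotDl !dotZl -/A -/C -/B [dot G G']dotC -/B.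
  have -> : A * B + - (B + e) * A = - (e * A) by ring.
  rewrite oppr_lt0 mulr_gt0 // => /(_ isT); lra.
have B0 : 0 < B.
  rewrite ltNge; apply/negP => B0.
  have := key2 (1 - B) ltac:(lra); rewrite addrCA subrr addr0 mul1r.
  have := mulr_gt0 A0 C0; lra.
have ACB : A * C <= B ^+ 2.
  apply/ler_addgt0Pr => e e0; apply: le_trans (key2 (e / B) _) _; first by rewrite divr_gt0.
  by rewrite mulrDl divfK ?gt_eqF.
have -> : dot nu G = B / Num.sqrt A.
  rewrite nuE dotZl euclid_normE -/A -/B; exact: mulrC.
have BE : B = Num.sqrt (B ^+ 2) by rewrite sqrtr_sqr gtr0_norm.
rewrite ler_pdivlMr ?sqrtr_gt0 // -(sqrtrM _ (ltW C0)) [leRHS]BE.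
by rewrite ler_sqrt ?sqr_ge0 // mulrC.
Unshelve. all: end_near. Qed.

Lemma normal_coord_le1 i : `|nu 0 i| <= 1.
Proof.
have [U' [phi' [ld' nuE]]] := hnu.
have [oU' Ux' sm' g0' H'] := ld'.
have A0 : 0 < dot (gradient phi' x) (gradient phi' x) by apply: dot_gt0; exact: g0'.
rewrite nuE mxE normrM normfV euclid_normE.
rewrite [`|Num.sqrt _|]ger0_norm ?sqrtr_ge0 // ler_pdivrMl ?sqrtr_gt0 // mulr1.
rewrite -sqrtr_sqr ler_sqrt ?(ltW A0) // /dot (bigD1 i) //= -expr2 lerDl.
by apply: sumr_ge0 => j _; rewrite -expr2 sqr_ge0.
Qed.

End normal.
End directional.

(** * Local barriers at boundary points *)

Lemma is_derive_quad (R : realType) (a0 a1 a2 s : R) :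
  is_derive s 1 (fun s : R => a0 + a1 * s + a2 * (s * s)) (a1 + 2 * a2 * s).
Proof.
have hi : is_derive s 1 (fun s : R => s) 1 by exact: is_derive_id.
have h0 : is_derive s 1 (fun=> a0) 0 by exact: is_derive_cst.
have h1 : is_derive s 1 (fun s : R => a1 * s) (a1 * 1) by exact: is_deriveZ.
have h2 := is_deriveM hi hi.
have h3 : is_derive s 1 (fun s : R => a2 * (s * s)) _ := is_deriveZ a2 h2.
have h := is_deriveD (is_deriveD h0 h1) h3.
by apply: is_derive_eq h _; rewrite /GRing.scale /=; ring.
Qed.

Lemma deriv2_at_quad (R : realType) (a0 a1 a2 : R) :
  deriv2_at (fun s : R => a0 + a1 * s + a2 * (s * s)) 0 (2 * a2).
Proof.
exists (fun s => a1 + 2 * a2 * s); split.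
  by near=> s; exact: is_derive_quad.
have := @is_derive_quad R a1 (2 * a2) 0 0.
have -> : (fun s : R => a1 + 2 * a2 * s + 0 * (s * s)) = (fun s => a1 + 2 * a2 * s).
  by apply/funext => s; ring.
by rewrite !mulr0 addr0.
Unshelve. all: end_near. Qed.

Section line2.
Context {R : realType} {n : nat}.
Implicit Types (x v : 'rV[R]_n) (f : 'rV[R]_n -> R).

Lemma line_is_derive0 f x v (d : R) : is_derive x v f d ->
  is_derive (0 : R) 1 (fun s => f (x + s *: v)) d.
Proof. by move=> h; apply: line_is_derive; rewrite scale0r addr0. Qed.

Lemma is_derive_line0 f x v (d : R) : is_derive (0 : R) 1 (fun s => f (x + s *: v)) d ->
  is_derive x v f d.
Proof. by move=> h; have := is_derive_line h; rewrite scale0r addr0. Qed.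

Lemma line_deriv2 (U : set 'rV[R]_n) f x i : open U -> U x ->
  (forall y, U y -> derivable f y (basis_rV i)) ->
  derivable (partial i f) x (basis_rV i) ->
  deriv2_at (fun s => f (x + s *: basis_rV i)) 0 (partial i (partial i f) x).
Proof.
move=> oU Ux df d2f; exists (fun s => partial i f (x + s *: basis_rV i)); split.
  have nU : \forall h \near (0 : R), U (x + h *: basis_rV i).
    by apply: near_line; exact: open_nbhs_nbhs.
  near=> s; apply: line_is_derive; apply: derivableP; apply: df; near: s; exact: nU.
by apply: line_is_derive0; exact: derivableP.
Unshelve. all: end_near. Qed.

Lemma is_derive_normal f x nu (a : R) : is_derive x (- nu) f (- a) ->
  is_normal_derivative f x nu a.
Proof.
move=> /is_derive_cvgE /cvg_dnbhs_at_right /cvgN; rewrite opprK /is_normal_derivative.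
apply: cvg_trans; apply: near_eq_cvg; near=> h.
change (- (h^-1 * (f (x + h *: - nu) - f x)) = h^-1 * (f x - f (x - h *: nu))).
by rewrite scalerN -mulrN opprB.
Unshelve. all: end_near. Qed.

Lemma continuous_sumr (T : topologicalType) (I : Type) (r : seq I) (F : I -> T -> R) (x : T) :
  (forall i, {for x, continuous (F i)}) ->
  {for x, continuous (fun y => \sum_(i <- r) F i y)}.
Proof.
move=> cF; elim: r => [|i r IH].
  have -> : (fun y => \sum_(i <- [::]) F i y) = (fun=> 0) by apply/funext => y; rewrite big_nil.
  exact: cvg_cst.
have -> : (fun y => \sum_(j <- i :: r) F j y) = (fun y => F i y + \sum_(j <- r) F j y).
  by apply/funext => y; rewrite big_cons.
by apply: cvgD; [exact: cF|exact: IH].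
Qed.

Lemma continuous_sqdist x0 : continuous (fun y : 'rV[R]_n => dot (y - x0) (y - x0)).
Proof.
move=> y; apply: continuous_sumr => i.
have cy : (fun z : 'rV[R]_n => (z - x0) 0 i) @ y --> (y - x0) 0 i.
  have -> : (fun z : 'rV[R]_n => (z - x0) 0 i) = (fun z => z 0 i - x0 0 i).
    by apply/funext => z; rewrite !mxE.
  have -> : (y - x0) 0 i = y 0 i - x0 0 i by rewrite !mxE.
  have cc : (fun z : 'rV[R]_n => z 0 i) @ y --> y 0 i := @coord_continuous R 1 n 0 i y.
  exact: (cvgB cc (cvg_cst (x0 0 i))).
exact: (cvgM cy cy).
Qed.

Lemma sqdist_line x0 x v (s : R) :
  dot (x + s *: v - x0) (x + s *: v - x0) =
  dot (x - x0) (x - x0) + (2 * dot v (x - x0)) * s + dot v v * (s * s).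
Proof.
rewrite /dot mulr_sumr !mulr_suml -!big_split /=; apply: eq_bigr => i _.
by rewrite !mxE; ring.
Qed.

Lemma dot_basis (i : 'I_n) : dot (basis_rV i) (basis_rV i) = 1 :> R.
Proof.
rewrite /dot (bigD1 i) //= !mxE !eqxx mulr1 big1 ?addr0 // => j ji.
by rewrite !mxE eqxx (negbTE ji) mulr0.
Qed.

Lemma sqdist_ge x : `|x| ^+ 2 <= dot x x.
Proof.
have [->|x0] := eqVneq `|x| 0.
  by rewrite expr0n /=; apply: sumr_ge0 => i _; rewrite -expr2 sqr_ge0.
have [[i j] /= xij] := mx_norm_neq0 x0.
rewrite [`|x|]xij (ord1 i) /dot (bigD1 j) //= real_normK ?num_real // expr2 lerDl.
by apply: sumr_ge0 => k _; rewrite -expr2 sqr_ge0.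
Qed.

Lemma dot_le_norm v x : (forall i, `|v 0 i| <= 1) -> `|dot v x| <= n%:R * `|x|.
Proof.
move=> v1; apply: le_trans (ler_norm_sum _ _ _) _.
have -> : n%:R * `|x| = \sum_(i < n) `|x| by rewrite sumr_const card_ord mulr_natl.
apply: ler_sum => i _; rewrite normrM; apply: le_trans (coord_le_norm x i).
by apply: ler_piMl.
Qed.
End line2.

(** The constant barrier 3 is used away from the boundary, hence the comparisons
    with 3: psi is the smaller of the two near its centre x0, so that the
    constant is never active at a boundary point, and the larger of the two on
    the sphere of radius r, so that psi is active only where it is smooth. *)
Record is_barrier (R : realType) n (Omega : set 'rV[R]_n) (nu : 'rV[R]_n -> 'rV[R]_n)
  (K Lam : R) (x0 : 'rV[R]_n) (r : R) (psi : 'rV[R]_n -> R) : Prop := {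
  barrier_radius : 0 < r;
  barrier_cont : forall y, `|y - x0| <= r -> {for y, continuous psi};
  barrier_ge : forall y, 2^-1 <= psi y;
  barrier_sphere : forall y, `|y - x0| = r -> 3 < psi y;
  barrier_near : \forall y \near x0, psi y < 3;
  barrier_lap : forall x, Omega x -> `|x - x0| < r ->
    exists b : 'I_n -> R,
      (forall i, deriv2_at (fun s => psi (x + s *: basis_rV i)) 0 (b i)) /\
      \sum_(i < n) b i <= Lam;
  barrier_normal : forall x, boundary Omega x -> `|x - x0| < r ->
    exists2 d, K < d & is_normal_derivative psi x (nu x) d
}.
Section barrier_existence.
Context {R : realType} {n : nat}.
Variables (Omega : set 'rV[R]_n) (nu : 'rV[R]_n -> 'rV[R]_n).
Hypothesis hnu : forall x, boundary Omega x -> unit_outward_normal Omega x (nu x).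

Lemma compact_closed_ball_rV (x : 'rV[R]_n) (r : R) :
  compact [set y : 'rV[R]_n | `|y - x| <= r].
Proof.
apply: bounded_closed_compact.
  exists (`|x| + r); split; first exact: num_real.
  move=> M hM y /= hy; apply: le_trans (ltW hM).
  by rewrite -[y](subrK x) addrC; apply: le_trans (ler_normD _ _) _; rewrite lerD2l.
rewrite (_ : [set y | _] = closed_ball_ (fun z : 'rV[R]_n => `|z|) x r).
  exact: closed_closed_ball_.
by apply/seteqP; split => y /=; rewrite /closed_ball_ /= distrC.
Qed.

(** The barrier is 1/2 + exp(2 M phi) / 2 + c |x - x0|^2 with c = 4 / r^2.  As
    phi <= 0 on the closure of Omega, the exponential stays between 0 and 1 there
    while its normal derivative at the boundary is 2 M |grad phi|; the size of M
    therefore affects the bound on the Laplacian only. *)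
Lemma exists_barrier (K : R) (x0 : 'rV[R]_n) : smooth_boundary Omega -> boundary Omega x0 ->
  exists r psi Lam, is_barrier Omega nu K Lam x0 r psi.
Proof.
move=> sb bx0; have [U [phi ld]] := sb _ bx0.
have [oU Ux0 sm g0 H] := ld.
have /nbhs_ballP[e /= e0 be] : nbhs x0 U by apply: open_nbhs_nbhs.
pose r := e / 2.
have r0 : 0 < r by rewrite divr_gt0.
have BU y : `|y - x0| <= r -> U y.
  move=> yr; apply: be; rewrite -ball_normE /= distrC; apply: le_lt_trans yr _.
  by rewrite /r; lra.
pose B := [set y : 'rV[R]_n | `|y - x0| <= r].
have cB : compact B := @compact_closed_ball_rV x0 r.
have cont_within (g : 'rV[R]_n -> R) : (forall y, U y -> {for y, continuous g}) ->
    {within B, continuous g}.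
  move=> cg; apply: continuous_in_subspaceT => y; rewrite inE => By; exact/cg/BU.
have /choice[M1 HM1] : forall i : 'I_n, exists M : R, 0 < M /\ forall y, B y ->
    `|partial i phi y| <= M /\ `|partial i (partial i phi) y| <= M.
  move=> i.
  have sm1 := smooth_on_partial i sm.
  have sm2 := smooth_on_partial i sm1.
  have [a a0 Ha] := compact_continuous_bound cB (cont_within _ (smooth_on_continuous sm1)).
  have [b b0 Hb] := compact_continuous_bound cB (cont_within _ (smooth_on_continuous sm2)).
  exists (a + b); split; first exact: addr_gt0.
  move=> y By; split.
    by apply: le_trans (Ha y By) _; rewrite lerDl ltW.
  by apply: le_trans (Hb y By) _; rewrite lerDr ltW.
have [m m0 Hm] : exists2 m, 0 < m &
    forall y, B y -> m <= Num.sqrt (dot (gradient phi y) (gradient phi y)).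
  have cG : {within B, continuous (fun y => dot (gradient phi y) (gradient phi y))}.
    apply: cont_within => y Uy; apply: continuous_sumr => i.
    have cp : partial i phi z @[z --> y] --> partial i phi y.
      exact: smooth_on_continuous (smooth_on_partial i sm) _ Uy.
    have -> : (fun z => gradient phi z 0 i * gradient phi z 0 i) =
        (fun z => partial i phi z * partial i phi z).
      by apply/funext => z; rewrite !mxE.
    exact: (cvgM cp cp).
  have [|c cB' Hc] := @compact_EVT_min _ _ _ B _ cB cG.
    by exists x0; rewrite /B /= subrr normr0 ltW.
  rewrite inE in cB'.
  exists (Num.sqrt (dot (gradient phi c) (gradient phi c))).
    by rewrite sqrtr_gt0 dot_gt0 // g0 //; exact: BU.
  by move=> y By; apply: ler_wsqrtr; apply: Hc; rewrite inE.
(* 8 n / r bounds the normal derivative of the quadratic term on the ball. *)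
pose M : R := (`|K| + 8 * n%:R / r + 1) / m.
have n0 : 0 <= n%:R :> R by exact: ler0n.
have M0 : 0 < M.
  by rewrite divr_gt0 // ltr_wpDl // addr_ge0 // divr_ge0 ?mulr_ge0 // ltW.
pose c : R := 4 / (r * r).
have c0 : 0 < c by rewrite divr_gt0 // mulr_gt0.
pose psi y := 2^-1 + 2^-1 * expR (2 * M * phi y) + c * dot (y - x0) (y - x0).
pose S1 := \sum_(i < n) M1 i.
have M1S i : M1 i <= S1.
  by rewrite /S1 (bigD1 i) //= lerDl; apply: sumr_ge0 => j _; apply: ltW; case: (HM1 j).
pose L := 2^-1 * (2 * M * S1 + (2 * M * S1) ^+ 2) + c * 2.
have phi_le0 y : U y -> Omega y -> phi y < 0 by move=> Uy Oy; apply/(H y Uy).1.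
have phi_bd y : U y -> boundary Omega y -> phi y = 0 by move=> Uy Oy; apply/(H y Uy).2.
have psi_cont y : `|y - x0| <= r -> {for y, continuous psi}.
  move=> yr.
  have c1 : phi z @[z --> y] --> phi y.
    exact: smooth_on_continuous sm _ (BU y yr).
  have c2 : expR (2 * M * phi z) @[z --> y] --> expR (2 * M * phi y).
    have c1' : 2 * M * phi z @[z --> y] --> 2 * M * phi y by exact: (cvgM (cvg_cst (2 * M)) c1).
    exact: (cvg_comp _ _ c1' (@continuous_expR R _)).
  have c3 := @continuous_sqdist R n x0 y.
  exact: (cvgD (cvgD (cvg_cst _) (cvgM (cvg_cst _) c2)) (cvgM (cvg_cst _) c3)).
have psi_line x v : (fun s => psi (x + s *: v)) = (fun s =>
   2^-1 * expR (2 * M * phi (x + s *: v)) +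
   ((2^-1 + c * dot (x - x0) (x - x0)) + (c * (2 * dot v (x - x0))) * s + (c * dot v v) * (s * s))).
  by apply/funext => s; rewrite /psi sqdist_line; ring.
exists r, psi, (\sum_(i < n) L); constructor.
- exact: r0.
- exact: psi_cont.
- move=> y; rewrite /psi -addrA lerDl; apply: addr_ge0.
    by rewrite mulr_ge0 ?expR_ge0.
  apply: mulr_ge0; first exact: ltW.
  by apply: sumr_ge0 => i _; rewrite -expr2 sqr_ge0.
- move=> y yr; have := sqdist_ge (y - x0); rewrite yr => q.
  have : c * r ^+ 2 <= c * dot (y - x0) (y - x0) by rewrite ler_pM2l.
  have -> : c * r ^+ 2 = 4 by rewrite /c; field; rewrite gt_eqF.
  have := expR_gt0 (2 * M * phi y); rewrite /psi; lra.
- have pc : psi z @[z --> x0] --> psi x0 by apply: psi_cont; rewrite subrr normr0 ltW.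
  apply: (cvgr_lt _ pc).
  rewrite /psi (phi_bd _ Ux0 bx0) mulr0 expR0 subrr.
  have -> : dot 0 (0 : 'rV[R]_n) = 0 by rewrite /dot big1 // => i _; rewrite mxE mul0r.
  lra.
- move=> x Ox xr; have Ux := BU x (ltW xr).
  exists (fun i => 2^-1 *
    ((2 * M * partial i (partial i phi) x + (2 * M * partial i phi x) ^+ 2) *
     expR (2 * M * phi x)) + c * 2); split.
    move=> i; rewrite psi_line.
    have d1 := smooth_on_derivable (i := i) sm.
    have d2 := smooth_on_derivable (i := i) (smooth_on_partial i sm).
    have D2 := line_deriv2 oU Ux d1 (d2 x Ux).
    have D1 : is_derive (0:R) 1 (fun s => phi (x + s *: basis_rV i)) (partial i phi x).
      by apply: line_is_derive0; apply: derivableP; exact: d1.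
    have E := deriv2_at_expR (2 * M) D1 D2.
    rewrite scale0r addr0 in E.
    have Q := deriv2_at_quad (2^-1 + c * dot (x - x0) (x - x0))
      (c * (2 * dot (basis_rV i) (x - x0))) (c * dot (basis_rV i) (basis_rV i)).
    have := deriv2_atD (deriv2_atZ 2^-1 E) Q.
    by rewrite dot_basis mulr1 [2 * c]mulrC.
  apply: ler_sum => i _; rewrite /L lerD2r ler_pM2l ?invr_gt0 //.
  have [M1i /(_ x (ltW xr)) [h1 h2]] := HM1 i.
  have h1' := le_trans h1 (M1S i); have h2' := le_trans h2 (M1S i).
  have S10 : 0 <= S1 by exact: le_trans (normr_ge0 _) h1'.
  have e1 : expR (2 * M * phi x) <= 1.
    rewrite -expR0 ler_expR; apply: mulr_ge0_le0; first by rewrite mulr_ge0 // ltW.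
    by apply: ltW; apply: phi_le0.
  have M20 : 0 < 2 * M by rewrite mulr_gt0.
  have a1 : 2 * M * partial i (partial i phi) x <= 2 * M * S1.
    rewrite (ler_pM2l M20); exact: le_trans (ler_norm _) h2'.
  have a2 : (2 * M * partial i phi x) ^+ 2 <= (2 * M * S1) ^+ 2.
    have MS0 : 0 <= 2 * M * S1 by rewrite mulr_ge0 // ltW.
    rewrite -[leLHS]real_normK ?num_real // ler_sqr ?nnegrE //.
    by rewrite normrM (gtr0_norm M20) (ler_pM2l M20).
  have a3 : 0 <= 2 * M * S1 + (2 * M * S1) ^+ 2.
    by rewrite addr_ge0 ?sqr_ge0 // mulr_ge0 // ltW.
  have ee := expR_gt0 (2 * M * phi x).
  apply: (@le_trans _ _ ((2 * M * S1 + (2 * M * S1) ^+ 2) * expR (2 * M * phi x))).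
    by rewrite ler_pM2r // lerD.
  by apply: ler_piMr.
- move=> x bx xr; have Ux := BU x (ltW xr).
  pose v := - nu x.
  pose a := M * dot (nu x) (gradient phi x) + c * (2 * dot (nu x) (x - x0)).
  exists a.
    have h1 := normal_dot_gradient bx (hnu bx) ld Ux.
    have h2 := le_trans (Hm x (ltW xr)) h1.
    have h3 : M * m <= M * dot (nu x) (gradient phi x) by rewrite ler_pM2l.
    have h4 : M * m = `|K| + 8 * n%:R / r + 1 by rewrite /M divfK // gt_eqF.
    have h5 := dot_le_norm (x - x0) (normal_coord_le1 (hnu bx)).
    have h6 : n%:R * `|x - x0| <= n%:R * r by rewrite ler_wpM2l // ltW.
    have h7 : - (n%:R * r) <= dot (nu x) (x - x0).
      by have := le_trans h5 h6; rewrite ler_norml => /andP[].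
    have h8 : - (8 * n%:R / r) <= c * (2 * dot (nu x) (x - x0)).
      have -> : - (8 * n%:R / r) = c * (2 * - (n%:R * r)) by rewrite /c; field; rewrite gt_eqF.
      by rewrite ler_pM2l // ler_pM2l.
    have := ler_norm K; rewrite /a; lra.
  apply: is_derive_normal; apply: is_derive_line0; rewrite psi_line.
  have D1 : is_derive (0:R) 1 (fun s => phi (x + s *: v)) (dot v (gradient phi x)).
    by apply: line_is_derive0; exact: smooth_on_is_derive oU sm Ux.
  have D2 := is_derive_expRM (2 * M) D1.
  have D3 : is_derive (0 : R) 1 (fun s => 2^-1 * expR (2 * M * phi (x + s *: v))) _ :=
    is_deriveZ 2^-1 D2.
  have Q := is_derive_quad (2^-1 + c * dot (x - x0) (x - x0))
    (c * (2 * dot v (x - x0))) (c * dot v v) 0.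
  apply: is_derive_eq (is_deriveD D3 Q) _.
  rewrite scale0r addr0 (phi_bd _ Ux bx) mulr0 expR0 /v -scaleN1r !dotZl /a /GRing.scale /=.
  by field.
Qed.
End barrier_existence.

(** * The maximum principle *)

Lemma seq_argmax (R : realType) (I : eqType) (s : seq I) (f : I -> R) (i0 : I) : i0 \in s ->
  exists2 i, i \in s & forall j, j \in s -> f j <= f i.
Proof.
elim: s i0 => // a s IH i0 _; case: s IH => [_|b s IH].
  by exists a; rewrite ?mem_head // => j; rewrite inE => /eqP ->.
have [i iS Hi] := IH b (mem_head _ _).
have [fai|fia] := leP (f a) (f i).
  exists i; first by rewrite inE iS orbT.
  by move=> j; rewrite inE => /orP[/eqP ->|/Hi].
exists a; first exact: mem_head.
move=> j; rewrite inE => /orP[/eqP -> //|/Hi h]; exact: le_trans h (ltW fia).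
Qed.

Section max_principle.
Context {R : realType} {n : nat}.
Variables (Omega : set 'rV[R]_n) (nu : 'rV[R]_n -> 'rV[R]_n).
Hypothesis oO : open Omega.
Hypothesis bO : bounded_set Omega.
Hypothesis sb : smooth_boundary Omega.
Hypothesis hnu : forall x, boundary Omega x -> unit_outward_normal Omega x (nu x).

Lemma boundaryE x : boundary Omega x <-> closure Omega x /\ ~ Omega x.
Proof. by rewrite /boundary (interior_id _).1. Qed.

Lemma closureE_boundary x : closure Omega x <-> Omega x \/ boundary Omega x.
Proof.
rewrite boundaryE; split.
  by move=> cx; have [|] := pselect (Omega x); [left|right].
by case=> [/subset_closure //|[]].
Qed.

Lemma compact_boundary : compact (boundary Omega).
Proof.
apply: (subclosed_compact _ (compact_closure_bounded bO)).
  by apply: closedI; [exact: closed_closure|apply: open_closedC; exact: open_interior].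
by move=> x [].
Qed.

Lemma finite_barriers (K : R) : exists (s : seq 'rV[R]_n) (r : 'rV[R]_n -> R)
    (psi : 'rV[R]_n -> 'rV[R]_n -> R) (L : R),
  [/\ 0 <= L, forall i, i \in s -> boundary Omega i /\ is_barrier Omega nu K L i (r i) (psi i) &
      forall x, boundary Omega x -> exists2 i, i \in s & psi i x < 3 /\ `|x - i| < r i].
Proof.
have H (x0 : 'rV[R]_n) : exists q : R * ('rV[R]_n -> R) * R, boundary Omega x0 ->
    is_barrier Omega nu K q.2 x0 q.1.1 q.1.2.
  have [bx|nbx] := pselect (boundary Omega x0); last by exists (0, fun=> 0, 0).
  by have [r [psi [L h]]] := exists_barrier hnu K sb bx; exists (r, psi, L).
have [q Hq] := choice H.
have := compact_boundary; rewrite compact_cover.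
pose f (i : 'rV[R]_n) := interior [set y | (q i).1.2 y < 3 /\ `|y - i| < (q i).1.1].
move=> /(_ _ (boundary Omega) f) [|x bx|s sb' cov].
- by move=> i _; exact: open_interior.
- exists x => //; rewrite /f /interior /=.
  have B := Hq x bx.
  apply: filterI; first exact: (barrier_near B).
  have := nbhsx_ballx x _ (barrier_radius B).
  by rewrite -ball_normE; apply: filterS => y /=; rewrite distrC.
have [L L0 HL] : exists2 L, 0 <= L & forall i, i \in finmap.enum_fset s -> (q i).2 <= L.
  elim: (finmap.enum_fset s) => [|a t [L L0 IH]]; first by exists 0.
  exists (Num.max L (q a).2); first by rewrite le_max L0.
  by move=> i; rewrite inE le_max => /orP[/eqP ->|/IH ->]; rewrite ?lexx ?orbT.
exists (finmap.enum_fset s), (fun i => (q i).1.1), (fun i => (q i).1.2), L; split => //.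
  move=> i si; have bi : boundary Omega i by have := sb' i si; rewrite inE.
  split=> //; case: (Hq i bi) => h1 h2 h3 h4 h5 h6 h7; constructor => //.
  move=> x Ox xr; have [b [hb1 hb2]] := h6 x Ox xr; exists b; split => //.
  exact: le_trans hb2 (HL i si).
move=> x bx; have [i /= si fi] := cov x bx; exists i => //.
exact: interior_subset fi.
Qed.

Variables (w : 'rV[R]_n -> R -> R) (T K : R).
Hypothesis T0 : 0 < T.
Hypothesis cw : {within closure Omega `*` `[0, T], continuous (fun z : 'rV[R]_n * R => w z.1 z.2)}.
Hypothesis w_init : forall x, closure Omega x -> w x 0 <= 0.
Hypothesis w_int : forall x t, Omega x -> 0 < t <= T -> 0 < w x t ->
  exists (a : R) (b : 'I_n -> R), [/\ is_derive t 1 (w x) a,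
    forall i, deriv2_at (fun s => w (x + s *: basis_rV i) t) 0 (b i) & a <= \sum_(i < n) b i].
(* M stands for any bound on w at time t: the boundary inequality is nonlocal
   in space. *)
Hypothesis w_bd : forall x t M, boundary Omega x -> 0 < t <= T -> 0 < w x t ->
  (forall y, closure Omega y -> w y t <= M) ->
  exists2 d, is_normal_derivative (w ^~ t) x (nu x) d & d <= K * M.

Section contradiction.
Variables (s : seq 'rV[R]_n) (r : 'rV[R]_n -> R) (psi : 'rV[R]_n -> 'rV[R]_n -> R) (L : R).
Hypothesis L0 : 0 <= L.
Hypothesis HB : forall i, i \in s ->
  boundary Omega i /\ is_barrier Omega nu (3 * K) L i (r i) (psi i).
Hypothesis cover_s : forall x, boundary Omega x ->
  exists2 i, i \in s & psi i x < 3 /\ `|x - i| < r i.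

Variables (x1 : 'rV[R]_n) (t1 : R).
Hypotheses (cx1 : closure Omega x1) (t1T : 0 <= t1 <= T) (w1 : 0 < w x1 t1).

(* [None] denotes the constant barrier, [Some i] the local barrier at i. *)
Let bar (o : option 'rV[R]_n) (x : 'rV[R]_n) : R := if o is Some i then psi i x else 3.
Let dom (o : option 'rV[R]_n) (x : 'rV[R]_n) : Prop :=
  if o is Some i then `|x - i| <= r i else True.
Let os := None :: map Some s.
(* Barriers are at least 1/2, so lam * psi exceeds every Laplacian bound L. *)
Let lam := 2 * L + 1.

Lemma bar_ge o x : o \in os -> 2^-1 <= bar o x.
Proof.
rewrite inE => /orP[/eqP -> /=|/mapP[i si -> /=]]; first by lra.
by have [_ B] := HB si; exact: (barrier_ge B).
Qed.

Lemma bar_gt0 o x : o \in os -> 0 < bar o x.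
Proof. by move=> /(bar_ge x); apply: lt_le_trans; rewrite invr_gt0. Qed.

Let A o := [set z : 'rV[R]_n * R | (closure Omega z.1 /\ dom o z.1) /\ 0 <= z.2 <= T].
Let F o (z : 'rV[R]_n * R) := w z.1 z.2 * expR (- (lam * z.2)) / bar o z.1.

Lemma bar_cont o x : o \in os -> dom o x -> {for x, continuous (bar o)}.
Proof.
rewrite inE => /orP[/eqP -> _|/mapP[i si -> /=]].
  exact: (@cst_continuous 'rV[R]_n R 3 x).
by have [_ B] := HB si; exact: (barrier_cont B).
Qed.

Lemma F_max o : o \in os -> exists2 z, A o z & forall z', A o z' -> F o z' <= F o z.
Proof.
move=> oos.
have AE : A o = (closure Omega `&` [set x | dom o x]) `*` `[0, T].
  by apply/seteqP; split => -[x t] /=; rewrite in_itv.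
have cdom : closed [set x | dom o x].
  move: oos; rewrite inE => /orP[/eqP -> /=|/mapP[i si ->] /=].
    by rewrite (_ : [set _ | _] = setT) //; exact: closedT.
  by apply: compact_closed => //; exact: compact_closed_ball_rV.
have cA : compact (A o).
  rewrite AE; apply: compact_setX; last exact: segment_compact.
  apply: (subclosed_compact _ (compact_closure_bounded bO)).
    by apply: closedI => //; exact: closed_closure.
  by move=> x [].
have cF : {within A o, continuous (F o)}.
  apply/subspace_continuousP => -[x0 t0] Az; set z := (x0, t0).
  have c1 : (fun z : 'rV[R]_n * R => w z.1 z.2) @ within (A o) (nbhs z) --> w z.1 z.2.
    have : {within A o, continuous (fun z : 'rV[R]_n * R => w z.1 z.2)}.
      apply: continuous_subspaceW cw; rewrite AE => y [[] ? _ ?]; by split.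
    by move/subspace_continuousP; apply.
  have c2 : (fun z : 'rV[R]_n * R => expR (- (lam * z.2))) @ within (A o) (nbhs z)
      --> expR (- (lam * z.2)).
    apply: cvg_within_filter.
    have : (fun z : 'rV[R]_n * R => - (lam * z.2)) @ z --> - (lam * z.2).
      by apply: cvgN; exact: (cvgM (cvg_cst lam) cvg_snd).
    by move=> c; exact: (cvg_comp _ _ c (@continuous_expR R _)).
  have c3 : (fun z : 'rV[R]_n * R => bar o z.1) @ within (A o) (nbhs z) --> bar o z.1.
    apply: cvg_within_filter.
    have c := @bar_cont o x0 oos Az.1.2.
    have c' : (fun z : 'rV[R]_n * R => z.1) @ z --> x0 by exact: cvg_fst.
    exact: (cvg_comp _ _ c' c).
  have b0 : bar o z.1 != 0 by rewrite gt_eqF // bar_gt0.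
  exact: (cvgM (cvgM c1 c2) (cvgV b0 c3)).
have [|z] := compact_EVT_max _ cA cF.
  move: oos; rewrite inE => /orP[/eqP ->|/mapP[i si ->]].
    by exists (x1, t1).
  have [[ci _] B] := HB si; exists (i, 0); split => /=; last by rewrite lexx ltW.
  by split => //; rewrite subrr normr0 ltW // (barrier_radius B).
by rewrite inE => Az Hz; exists z => // z' Az'; apply: Hz; rewrite inE.
Qed.

(** E exp(lam (t' - t)) psi lies above w for every barrier psi, with equality at
    (x, t) for one of them.  Maximising the quotients over all barriers is what
    replaces the minimum of the barriers, which would not be smooth. *)
Lemma touching_point : exists o x t E, [/\ o \in os, A o (x, t), 0 < t, 0 < E &
  w x t = E * bar o x /\
  forall o' y t', o' \in os -> A o' (y, t') -> w y t' <= E * expR (lam * (t' - t)) * bar o' y].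
Proof.
have H (o : option 'rV[R]_n) : exists z, o \in os -> A o z /\ forall z', A o z' -> F o z' <= F o z.
  have [oos|no] := boolP (o \in os); last by exists (x1, t1).
  by have [z Az Hz] := F_max oos; exists z.
have [z Hz] := choice H.
have [ o oos Ho] := @seq_argmax R _ os (fun o => F o (z o)) None (mem_head _ _).
have [Az _] := Hz o oos.
case zE : (z o) Az => [x t] Az.
have mF o' y : o' \in os -> A o' y -> F o' y <= F o (x, t).
  move=> o's Ay; rewrite -zE; apply: le_trans (Ho o' o's).
  by have [_] := Hz o' o's; apply.
have b0 := @bar_gt0 o x oos.
have m0 : 0 < F o (x, t).
  have : A None (x1, t1) by [].
  move/(mF None _ (mem_head _ _)); apply: lt_le_trans.
  by rewrite /F /= divr_gt0 // mulr_gt0 // expR_gt0.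
have wxt : w x t = F o (x, t) * expR (lam * t) * bar o x.
  by rewrite /F /= expRN; field; rewrite !gt_eqF ?expR_gt0.
exists o, x, t, (F o (x, t) * expR (lam * t)); split => //.
- have [[cx _] /andP[t0 _]] := Az.
  rewrite lt_def t0 andbT; apply/eqP => /= t00.
  have : 0 < w x t by rewrite wxt mulr_gt0 // mulr_gt0 // expR_gt0.
  by rewrite t00 ltNge (w_init cx).
- by rewrite mulr_gt0 // expR_gt0.
split => // o' y t' o's Ay.
have := mF o' (y, t') o's Ay.
rewrite {1}/F /= ler_pdivrMr; last exact: bar_gt0.
rewrite expRN ler_pdivrMr ?expR_gt0 // => h; apply: le_trans h _.
rewrite -[_ * expR (lam * t) * _]mulrA -expRD le_eqVlt; apply/orP; left; apply/eqP.
have -> : lam * t + lam * (t' - t) = lam * t' by ring.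
ring.
Qed.

Lemma no_positive_value : False.
Proof.
have [ o [x [t [E [oos [[cx ox] /andP[_ tT]] /= t0 E0 [wE H]]]]]] := touching_point.
have Hx o' y : o' \in os -> closure Omega y -> dom o' y -> w y t <= E * bar o' y.
  move=> o's cy dy; have := H o' y t o's.
  by rewrite subrr mulr0 expR0 mulr1; apply; split => //=; rewrite ltW.
have w3 y : closure Omega y -> w y t <= E * 3.
  by move=> cy; apply: (Hx None) => //; exact: mem_head.
have wpos : 0 < w x t by rewrite wE mulr_gt0 // bar_gt0.
have tT' : 0 < t <= T by rewrite t0.
(* On the sphere the constant barrier would give a larger quotient. *)
have inner i : o = Some i -> `|x - i| < r i.
  move=> oi; move: oos ox wE; rewrite oi /= => ios xi wE.
  rewrite lt_def xi andbT; apply/eqP => xr.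
  have si : i \in s.
    by move: ios; rewrite inE => /orP[//|/mapP[j js [->]]].
  have [_ B] := HB si.
  have := barrier_sphere B (esym xr); have := w3 x cx.
  by rewrite wE ler_pM2l // => h1 h2; have := lt_le_trans h2 h1; rewrite ltxx.
have [Ox|bx] := (closureE_boundary x).1 cx; last first.
  (* A local barrier below 3 covers x, so the active one is not the constant. *)
  have [j sj [pj xj]] := cover_s bx.
  have wj : w x t < E * 3.
    apply: (@le_lt_trans _ _ (E * psi j x)); last by rewrite ltr_pM2l.
    apply: (Hx (Some j)) => //; last exact: ltW.
    by rewrite inE; apply/orP; right; apply: map_f.
  case: o oos ox wE inner => [i|] oos ox wE inner; last first.
    by move: wj; rewrite wE /= ltxx.
  have xr := inner i erefl.
  have si : i \in s.
    by move: oos; rewrite inE => /orP[//|/mapP[k ks [->]]].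
  have [_ B] := HB si.
  have [d Kd nd] := barrier_normal B bx xr.
  have [d' nd' d'K] := w_bd bx tT' wpos w3.
  suff : E * d <= d'.
    move=> /le_trans /(_ d'K); have : E * (3 * K) < E * d by rewrite ltr_pM2l.
    by lra.
  have ndE : E * (h^-1 * (psi i x - psi i (x - h *: nu x))) @[h --> 0^'+] --> E * d.
    exact: (cvgM (cvg_cst E) nd).
  apply: (ler_cvg_to ndE nd').
  have nin := normal_inward bx (hnu bx).
  have nball : \forall h \near 0^'+, `|x - h *: nu x - i| < r i.
    apply: near0_right.
    have nb : nbhs x (ball i (r i)).
      by apply: open_nbhs_nbhs; split; [exact: ball_open|rewrite -ball_normE /= distrC].
    have := near_line (- nu x) nb; apply: filterS => h.
    by rewrite scalerN -ball_normE /= distrC.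
  near=> h.
  have h0 : 0 < h by near: h; exact: nbhs_right_gt.
  rewrite mulrCA ler_pM2l ?invr_gt0 // mulrBr -wE.
  rewrite lerD2l lerN2; apply: (Hx (Some i)) => //.
    by apply: subset_closure; near: h; exact: nin.
  by apply: ltW; near: h; exact: nball.
have [a [b [da db ab]]] := w_int Ox tT' wpos.
have [b' [db' b'L] nb] : exists2 b' : 'I_n -> R,
    (forall i, deriv2_at (fun s => bar o (x + s *: basis_rV i)) 0 (b' i)) /\
    \sum_(i < n) b' i <= L & nbhs x [set y | dom o y].
  case: o oos ox wE inner => [i|] oos ox wE inner; last first.
    exists (fun=> 0); last by apply: filterE.
    by split => [i|]; [exact: deriv2_at_cst|rewrite big1].
  have xr := inner i erefl.
  have si : i \in s.
    by move: oos; rewrite inE => /orP[//|/mapP[k ks [->]]].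
  have [_ B] := HB si.
  have [b' hb'] := barrier_lap B Ox xr; exists b' => //=.
  apply: (filterS (P := ball i (r i))).
    by move=> y; rewrite -ball_normE /= distrC => /ltW.
  apply: open_nbhs_nbhs; split; first exact: ball_open.
  by rewrite -ball_normE /= distrC.
have nO : nbhs x Omega by apply: open_nbhs_nbhs.
have a_ge : E * bar o x * lam <= a.
  have D0 : is_derive t 1 (fun s => s - t) 1.
    by apply: is_derive_eq (is_deriveB (is_derive_id t 1) (is_derive_cst t t 1)) _; rewrite subr0.
  have D1 := is_derive_expRM lam D0.
  rewrite subrr mulr0 expR0 !mulr1 in D1.
  have D2 : is_derive t 1 (fun s => (E * bar o x) * expR (lam * (s - t))) (E * bar o x * lam).
    exact: is_deriveZ.
  have D3 : is_derive t 1 (fun s => w x s - (E * bar o x) * expR (lam * (s - t)))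
      (a - E * bar o x * lam).
    exact: is_deriveB.
  rewrite -subr_ge0; apply: (left_max_derive_ge0 D3).
  have : \forall s \near t, 0 < s by apply: open_nbhs_nbhs; split; [exact: open_gt|].
  apply: filterS => s' s0 st.
  rewrite [leRHS](_ : _ = 0); last by rewrite subrr mulr0 expR0 mulr1 wE subrr.
  rewrite subr_le0 mulrAC; apply: H => //; split => //=.
  by rewrite ltW //= (le_trans st).
have b_le i : b i <= E * b' i.
  rewrite -subr_le0; apply: (local_max_deriv2_le0 (deriv2_atB (db i) (deriv2_atZ E (db' i)))).
  have nI : nbhs x (Omega `&` [set y | dom o y]) by exact: filterI.
  have := near_line (basis_rV i) nI; apply: filterS => s' [Os ds] /=.
  rewrite scale0r addr0 wE subrr subr_le0; apply: Hx => //.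
  exact: subset_closure.
have : \sum_(i < n) b i <= E * L.
  apply: (@le_trans _ _ (\sum_(i < n) E * b' i)); first exact: ler_sum.
  by rewrite -mulr_sumr ler_pM2l.
move=> bL; have := le_trans a_ge (le_trans ab bL).
rewrite -mulrA ler_pM2l // leNgt => /negP; apply.
apply: (@lt_le_trans _ _ (2^-1 * lam)); first by rewrite /lam; lra.
by rewrite ler_pM2r ?bar_ge // /lam; have := L0; lra.
Unshelve. all: end_near. Qed.
End contradiction.

(** The differential inequality is required only where w > 0, as this is where
    the sign of the absorption term is known. *)
Theorem max_principle x t : closure Omega x -> 0 <= t <= T -> w x t <= 0.
Proof.
move=> cx tT; rewrite leNgt; apply/negP => wpos.
have [s [r [psi [L [L0 HB cov]]]]] := finite_barriers (3 * K).
by apply: no_positive_value; [exact: L0|exact: HB|exact: cov|exact: cx|exact: tT|exact: wpos].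
Qed.
End max_principle.

(** * One-sided Lipschitz bounds for powers *)

Section powers.
Context {R : realType}.

Lemma bernoulli_sub (theta : R) (N : nat) : 0 <= theta <= 1 ->
  1 - theta ^+ N <= N%:R * (1 - theta).
Proof.
move=> /andP[t0 t1]; elim: N => [|N IH]; first by rewrite expr0 subrr mul0r.
have -> : 1 - theta ^+ N.+1 = (1 - theta) + theta * (1 - theta ^+ N) by rewrite exprS; ring.
rewrite -natr1 mulrDl mul1r addrC; apply: lerD => //.
apply: le_trans IH; apply: ler_piMl => //; rewrite subr_ge0; exact: exprn_ile1.
Qed.

(** With theta = b / a in [0, 1], theta `^ l >= theta ^+ N reduces the estimate to
    Bernoulli's inequality for integer exponents. *)
Lemma powR_sub_le_nat (l a b : R) (N : nat) : (0 < N)%N -> 0 < l <= N%:R ->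
  0 < a -> 0 <= b <= a ->
  a `^ l - b `^ l <= N%:R * a `^ (l - 1) * (a - b).
Proof.
move=> N0 /andP[l0 lN] a0 /andP[b0 ba].
pose theta := b / a.
have t0 : 0 <= theta by rewrite divr_ge0 // ltW.
have t1 : theta <= 1 by rewrite ler_pdivrMr // mul1r.
have bE : b = theta * a by rewrite /theta divfK // gt_eqF.
have h : theta ^+ N <= theta `^ l.
  have [->|tn0] := eqVneq theta 0.
    by rewrite powR0 ?gt_eqF // expr0n gtn_eqF.
  rewrite -powR_mulrn //.
  have t01 : 0 < theta <= 1 by rewrite lt_def tn0 t0.
  exact: (ger_powR t01 lN).
have -> : b `^ l = theta `^ l * a `^ l by rewrite -powRM -?bE // ltW.
have -> : a - b = a * (1 - theta) by rewrite mulrBr mulr1 [a * theta]mulrC -bE.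
have -> : N%:R * a `^ (l - 1) * (a * (1 - theta)) = a `^ l * (N%:R * (1 - theta)).
  by rewrite -(mulr_powRB1 (ltW a0) l0); ring.
have -> : a `^ l - theta `^ l * a `^ l = a `^ l * (1 - theta `^ l) by ring.
rewrite ler_wpM2l ?powR_ge0 //.
apply: le_trans (bernoulli_sub N _); last by rewrite t0.
by rewrite lerD2l lerN2.
Qed.

(** The factor a `^ (l - 1) is bounded by its value at B if l >= 1 and at d if
    l < 1; the smaller argument b may vanish in both cases. *)
Lemma powR_sub_le (l d B : R) : 0 < l -> 1 <= l \/ 0 < d -> exists2 C, 0 <= C &
  forall a b, 0 <= b <= a -> d <= a <= B -> a `^ l - b `^ l <= C * (a - b).
Proof.
move=> l0 ld.
pose N := (Num.truncn l).+1.
have lN : 0 < l <= N%:R by rewrite l0 /= ltW // truncnS_gt.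
have [l1|l1] := leP 1 l.
  exists (N%:R * B `^ (l - 1)); first by rewrite mulr_ge0 ?powR_ge0.
  move=> a b /andP[b0 ba] /andP[da aB].
  have [a0|a0] := eqVneq a 0.
    have -> : b = a by apply/eqP; rewrite eq_le ba a0 b0.
    by rewrite !subrr mulr0.
  have ap : 0 < a by rewrite lt_def a0 (le_trans b0).
  apply: le_trans (powR_sub_le_nat _ lN ap _) _ => //; first by rewrite b0.
  rewrite ler_wpM2r ?subr_ge0 // ler_wpM2l //.
  by apply: ge0_ler_powR => //; rewrite ?nnegrE ?subr_ge0 // ltW // (lt_le_trans ap).
have d0 : 0 < d by case: ld => // /le_lt_trans /(_ l1); rewrite ltxx.
exists (N%:R * (d `^ (1 - l))^-1); first by rewrite mulr_ge0 ?invr_ge0 ?powR_ge0.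
move=> a b /andP[b0 ba] /andP[da aB].
have ap : 0 < a by exact: lt_le_trans da.
apply: le_trans (powR_sub_le_nat _ lN ap _) _ => //; first by rewrite b0.
rewrite ler_wpM2r ?subr_ge0 // ler_wpM2l //.
rewrite -opprB powRN lef_pV2 ?posrE ?powR_gt0 //.
by apply: ge0_ler_powR => //; rewrite ?nnegrE ?subr_ge0 // ltW.
Qed.
End powers.

(** * Comparison and positivity of solutions *)

Section solutions.
Context {R : realType} {n : nat}.

Lemma is_normal_derivativeB (f g : 'rV[R]_n -> R) x nu a b :
  is_normal_derivative f x nu a -> is_normal_derivative g x nu b ->
  is_normal_derivative (fun y => f y - g y) x nu (a - b).
Proof.
rewrite /is_normal_derivative => df dg.
have := cvgB df dg.
have -> : (fun h : R => h^-1 * (f x - f (x - h *: nu))) -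
    (fun h : R => h^-1 * (g x - g (x - h *: nu))) =
   (fun h => h^-1 * ((f x - g x) - (f (x - h *: nu) - g (x - h *: nu)))).
  apply/funext => h.
  change (h^-1 * (f x - f (x - h *: nu)) - h^-1 * (g x - g (x - h *: nu)) =
    h^-1 * ((f x - g x) - (f (x - h *: nu) - g (x - h *: nu)))).
  ring.
exact.
Qed.

Lemma is_normal_derivative_cst (a : R) (x nu : 'rV[R]_n) :
  is_normal_derivative (fun=> a) x nu 0.
Proof.
rewrite /is_normal_derivative; under eq_fun do rewrite subrr mulr0.
exact: cvg_cst.
Qed.

Lemma sub_sub_le (a b e f : R) : f <= e -> a - e - (b - f) <= a - b.
Proof. by lra. Qed.

Lemma continuous_within_comp (S T U : topologicalType) (A : set T) (B : set S)
    (F : T -> U) (g : S -> T) :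
  {within A, continuous F} -> {within B, continuous g} -> (forall x, B x -> A (g x)) ->
  {within B, continuous (F \o g)}.
Proof.
move=> /subspace_continuousP cF /subspace_continuousP cg gBA.
apply/subspace_continuousP => x Bx P /= FP.
have := cF (g x) (gBA x Bx) P FP; rewrite /= !nbhs_simpl /within /= => H.
have := cg x Bx _ H; rewrite /= !nbhs_simpl /within /=.
by apply: filterS => y Hy By; apply: Hy => //; exact: gBA.
Qed.

Lemma closure_eq (Omega : set 'rV[R]_n) (f g : 'rV[R]_n -> R) :
  {within closure Omega, continuous f} -> {within closure Omega, continuous g} ->
  (forall x, Omega x -> f x = g x) -> forall x, closure Omega x -> f x = g x.
Proof.
move=> /subspace_continuousP cf /subspace_continuousP cg fg x cx.
apply/eqP; rewrite -subr_eq0; apply/negPn/negP => fgx.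
have cfg : (fun y => f y - g y) @ within (closure Omega) (nbhs x) --> f x - g x.
  exact: (cvgB (cf x cx) (cg x cx)).
have e0 : 0 < `|f x - g x| by rewrite normr_gt0.
have /cvgr_dist_lt /(_ _ e0) := cfg.
rewrite /within /= => H.
have [y [Oy /(_ (subset_closure Oy))]] := cx _ H.
by rewrite (fg y Oy) subrr subr0 ltxx.
Qed.

Lemma closed_cylinderE (Omega : set 'rV[R]_n) (T : R) x t : open Omega -> 0 < T ->
  closed_cylinder Omega T (x, t) <-> closure Omega x /\ 0 <= t < T.
Proof.
move=> oO T0; rewrite /closed_cylinder /cylinder /=; split.
  case=> [[Ox]|[[bx]|[cx ->]]].
  - rewrite /= in_itv /= => /andP[t0 tT]; rewrite (ltW t0) tT; split=> //; exact: subset_closure.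
  - rewrite /= in_itv /= => /andP[t0 tT]; rewrite (ltW t0) tT; split=> //; by case: bx.
  - by rewrite lexx T0.
move=> [cx /andP[]]; rewrite le_eqVlt => /orP[/eqP <- _|t0 tT].
  by right; right.
have [Ox|bx] := (closureE_boundary oO x).1 cx; [left|right; left].
  by split => //=; rewrite in_itv /= t0.
by split => //=; rewrite in_itv /= t0.
Qed.

Section uniqueness.
Variables (Omega : set 'rV[R]_n) (nu : 'rV[R]_n -> 'rV[R]_n).
Hypothesis hOmega : bounded_smooth_domain Omega.
Hypothesis hnu : forall x, boundary Omega x -> unit_outward_normal Omega x (nu x).
Variables (p l : R) (c : 'rV[R]_n -> R -> R) (k : 'rV[R]_n -> 'rV[R]_n -> R -> R).
Variables (u0 : 'rV[R]_n -> R) (T : R).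
Hypotheses (p0 : 0 < p) (l0 : 0 < l) (T0 : 0 < T).
Hypothesis c_ge0 : forall x t, closure Omega x -> 0 <= t -> 0 <= c x t.
Hypothesis k_cont : {within boundary Omega `*` closure Omega `*` `[0, +oo[,
     continuous (fun z : 'rV[R]_n * 'rV[R]_n * R => k z.1.1 z.1.2 z.2)}.
Hypothesis k_ge0 : forall x y t,
     boundary Omega x -> closure Omega y -> 0 <= t -> 0 <= k x y t.

Local Notation sol := (is_solution Omega nu p l c k u0 T).

Let oO : open Omega. Proof. by case: hOmega. Qed.
Let bO : bounded_set Omega. Proof. by case: hOmega. Qed.
Let sb : smooth_boundary Omega. Proof. by case: hOmega. Qed.

Lemma sol_continuous u T' : sol u -> T' < T ->
  {within closure Omega `*` `[0, T'], continuous (fun z : 'rV[R]_n * R => u z.1 z.2)}.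
Proof.
move=> [_ [_ [cu _]] _ _ _] T'T; apply: continuous_subspaceW cu => -[x t] [/= cx].
rewrite in_itv /= => /andP[t0 tT']; apply/closed_cylinderE => //.
by rewrite t0 (le_lt_trans tT').
Qed.

Lemma sol_slice_continuous u t : sol u -> 0 <= t < T ->
  {within closure Omega, continuous (u ^~ t)}.
Proof.
move=> su /andP[t0 tT].
have cu := sol_continuous su tT.
apply: (@continuous_within_comp _ _ _ _ (closure Omega) _ (fun x : 'rV[R]_n => (x, t)) cu).
  apply: continuous_subspaceT => x.
  exact: (@cvg_pair _ _ _ (nbhs x) (nbhs x) (nbhs t) _ _ _ id (fun=> t) cvg_id (cvg_cst t)).
by move=> x cx; split => //=; rewrite in_itv /= t0 lexx.
Qed.

Lemma sol_ge0 u x t : sol u -> closure Omega x -> 0 <= t < T -> 0 <= u x t.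
Proof. by move=> [u_ge0 _ _ _ _] cx tT; apply: u_ge0; apply/closed_cylinderE. Qed.

Lemma sol_bound u T' : sol u -> T' < T ->
  exists2 B, 0 < B & forall x t, closure Omega x -> 0 <= t <= T' -> u x t <= B.
Proof.
move=> su T'T.
have cK : compact (closure Omega `*` `[0, T']).
  by apply: compact_setX; [exact: compact_closure_bounded|exact: segment_compact].
have [B B0 HB] := compact_continuous_bound cK (sol_continuous su T'T).
exists B => // x t cx tT; apply: le_trans (ler_norm _) _.
by apply: (HB (x, t)); split => //=; rewrite in_itv.
Qed.

Lemma kernel_slice_continuous x t : boundary Omega x -> 0 <= t ->
  {within closure Omega, continuous (fun y => k x y t)}.
Proof.
move=> bx t0.
apply: (@continuous_within_comp _ _ _ _ (closure Omega) _ (fun y : 'rV[R]_n => (x, y, t)) k_cont).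
  apply: continuous_subspaceT => y.
  have cxy : (fun y : 'rV[R]_n => (x, y)) @ y --> (x, y).
    exact: (@cvg_pair _ _ _ (nbhs y) (nbhs x) (nbhs y) _ _ _ (fun=> x) id (cvg_cst x) cvg_id).
  exact: (@cvg_pair _ _ _ (nbhs y) (nbhs (x, y)) (nbhs t) _ _ _ _ (fun=> t) cxy (cvg_cst t)).
by move=> y cy; split => //=; rewrite in_itv /= t0.
Qed.

Lemma kernel_bound T' : exists2 B, 0 < B & forall x y t, boundary Omega x ->
  closure Omega y -> 0 <= t <= T' -> k x y t <= B.
Proof.
have cK : compact (boundary Omega `*` closure Omega `*` `[0, T']).
  apply: compact_setX; last exact: segment_compact.
  by apply: compact_setX; [exact: compact_boundary|exact: compact_closure_bounded].
have cont : {within boundary Omega `*` closure Omega `*` `[0, T'],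
     continuous (fun z : 'rV[R]_n * 'rV[R]_n * R => k z.1.1 z.1.2 z.2)}.
  apply: continuous_subspaceW k_cont => -[[x y] t] [[/= bx cy]].
  by rewrite in_itv /= => /andP[t0 _]; split => //=; rewrite in_itv /= t0.
have [B B0 HB] := compact_continuous_bound cK cont.
exists B => // x y t bx cy tT; apply: le_trans (ler_norm _) _.
by apply: (HB (x, y, t)); split => //=; rewrite in_itv.
Qed.

Lemma sol_derivatives u x t : sol u -> Omega x -> 0 < t < T ->
  [/\ is_derive t 1 (u x) (partial_t u x t),
      forall i, deriv2_at (fun s => u (x + s *: basis_rV i) t) 0 (partial_x i (partial_x i u) x t) &
      partial_t u x t = laplacian u x t - c x t * u x t `^ p].
Proof.
move=> [_ [[_ [dt _] dx dxx] _] pde _ _] Ox tT.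
have D y : Omega y -> cylinder Omega T (y, t) by move=> Oy; split => //=; rewrite in_itv.
split.
- by rewrite /partial_t derive1E; apply: derivableP; exact: dt _ (D x Ox).
- move=> i.
  have d1 y : Omega y -> derivable (u ^~ t) y (basis_rV i).
    by move=> Oy; have [d _] := dx i; exact: d _ (D y Oy).
  have d2 : derivable (partial i (u ^~ t)) x (basis_rV i).
    by have [d _] := dxx i i; exact: d _ (D x Ox).
  exact: line_deriv2 oO Ox d1 d2.
- exact: pde _ _ (D x Ox).
Qed.

(** The lower bound d is needed for the larger of the two values only, because
    it is used where v exceeds u, with a = v and b = u in [powR_sub_le]. *)
Lemma sol_le (u v : 'rV[R]_n -> R -> R) T' d : sol u -> sol v -> 0 < T' < T ->
  1 <= l \/ 0 < d ->
  (forall x t, closure Omega x -> 0 <= t <= T' -> d <= Num.max (u x t) (v x t)) ->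
  forall x t, closure Omega x -> 0 <= t <= T' -> v x t <= u x t.
Proof.
move=> su sv /andP[T'0 T'T] ld hd x t cx tT'.
have [Bv Bv0 HBv] := sol_bound sv T'T.
have [C C0 HC] := powR_sub_le Bv l0 ld.
have [Bk Bk0 HBk] := kernel_bound T'.
pose K := Bk * C * volume Omega.
rewrite -subr_le0.
apply: (@max_principle R n Omega nu oO bO sb hnu (fun x t => v x t - u x t) T' K T'0) => //.
- apply/subspace_continuousP => z Az.
  have /subspace_continuousP /(_ z Az) cv := sol_continuous sv T'T.
  have /subspace_continuousP /(_ z Az) cu := sol_continuous su T'T.
  exact: (cvgB cv cu).
- move=> y cy; rewrite subr_le0 le_eqVlt; apply/orP; left; apply/eqP.
  apply: (closure_eq (sol_slice_continuous sv _) (sol_slice_continuous su _) _ cy); rewrite ?lexx //.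
  by move=> z Oz; case: su => _ _ _ _ ->//; case: sv => _ _ _ _ ->.
- move=> y s Oy /andP[s0 sT'] ws.
  have sT : 0 < s < T by rewrite s0 (le_lt_trans sT').
  have cy : closure Omega y by exact: subset_closure.
  have [dv d2v ev] := sol_derivatives sv Oy sT.
  have [du d2u eu] := sol_derivatives su Oy sT.
  exists (partial_t v y s - partial_t u y s),
    (fun i => partial_x i (partial_x i v) y s - partial_x i (partial_x i u) y s); split.
  + exact: is_deriveB.
  + by move=> i; exact: deriv2_atB.
  + rewrite sumrB ev eu.
    have uy0 : 0 <= u y s by apply: sol_ge0 su cy _; rewrite ltW //=; case/andP: sT.
    have uv : u y s <= v y s by rewrite -subr_ge0 ltW.
    apply: sub_sub_le; apply: ler_wpM2l; first by apply: c_ge0 => //; exact: ltW.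
    by apply: (ge0_ler_powR (ltW p0) _ _ uv); rewrite nnegrE // (le_trans uy0 uv).
- move=> y s M bz /andP[s0 sT'] ws HM.
  have sT : 0 <= s < T by rewrite ltW //= (le_lt_trans sT').
  have [_ _ _ nv _] := sv; have [_ _ _ nu' _] := su.
  have cy : closure Omega y by case: bz.
  exists (integral_rV Omega (fun z => k y z s * v z s `^ l) -
    integral_rV Omega (fun z => k y z s * u z s `^ l)).
    exact: is_normal_derivativeB (nv y s bz sT) (nu' y s bz sT).
  have -> : K * M = (Bk * C * M) * volume Omega by rewrite /K; ring.
  have ik := @integrable_mul_powR R n Omega oO bO (fun z => k y z s) _ l (ltW l0)
    (kernel_slice_continuous bz (ltW s0)).
  apply: (@le_integral_rV R n Omega oO bO).
  + exact: (ik (v ^~ s) (sol_slice_continuous sv sT) (fun z cz => sol_ge0 sv cz sT)).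
  + exact: (ik (u ^~ s) (sol_slice_continuous su sT) (fun z cz => sol_ge0 su cz sT)).
  + move=> z Oz; have cz := subset_closure Oz.
    have M0 : 0 <= M by apply: le_trans (HM _ cy); exact: ltW.
    have uz0 : 0 <= u z s by exact: sol_ge0.
    have vz0 : 0 <= v z s by exact: sol_ge0.
    have kz0 : 0 <= k y z s by apply: k_ge0 => //; exact: ltW.
    have sTl : 0 <= s <= T' by rewrite ltW.
    rewrite -mulrBr; have [vu|uv] := leP (v z s) (u z s).
      apply: (@le_trans _ _ 0); last by rewrite !mulr_ge0 // ltW.
      apply: mulr_ge0_le0 => //; rewrite subr_le0.
      exact: (ge0_ler_powR (ltW l0) _ _ vu).
    have dle := hd z s cz sTl; rewrite (max_idPr (ltW uv)) in dle.
    have h1 : v z s `^ l - u z s `^ l <= C * (v z s - u z s).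
      by apply: HC; rewrite ?uz0 ?dle //= ?HBv // ltW.
    have h2 : C * (v z s - u z s) <= C * M by apply: ler_wpM2l => //; exact: HM.
    rewrite -mulrA; apply: ler_pM => //; last exact: le_trans h1 h2.
      by rewrite subr_ge0; exact: (ge0_ler_powR (ltW l0) _ _ (ltW uv)).
    exact: HBk.
Unshelve. all: end_near. Qed.

Hypothesis u0_C1 : C1_closure Omega u0.

Lemma sol_initial u x : sol u -> closure Omega x -> u x 0 = u0 x.
Proof.
move=> su cx; have c1 := sol_slice_continuous (t := 0) su.
rewrite lexx T0 in c1; have [c2 _] := u0_C1.
by apply: (closure_eq (c1 isT) c2 _ cx) => z Oz; case: su => _ _ _ _ ->.
Qed.

Lemma integral_kernel_ge0 u x t : sol u -> boundary Omega x -> 0 <= t < T ->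
  0 <= integral_rV Omega (fun y => k x y t * u y t `^ l).
Proof.
move=> su bx tT; apply: Rintegral_ge0 => y /= Oy.
apply: mulr_ge0; last exact: powR_ge0.
by apply: k_ge0 => //; [exact: subset_closure|case/andP: tT].
Qed.

(** d0 exp(- lam t) is a subsolution: where it exceeds u, the bound
    c u ^ p <= Bc Bu ^ (p - 1) u = lam u <= lam d0 exp(- lam t) controls the
    absorption, and the flux of u is nonnegative. *)
Lemma sol_positive u T' Bc : sol u -> 0 < T' < T -> 1 <= p ->
  (forall x, closure Omega x -> 0 < u0 x) ->
  (forall x t, closure Omega x -> 0 <= t <= T' -> c x t <= Bc) ->
  exists2 d, 0 < d & forall x t, closure Omega x -> 0 <= t <= T' -> d <= u x t.
Proof.
move=> su /andP[T'0 T'T] p1 u0_gt0 cB.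
have [x0 Ox0] : Omega !=set0 by case: hOmega.
have [cu0 _] := u0_C1.
have cO : closure Omega !=set0 by exists x0; exact: subset_closure.
have [xm] := compact_EVT_min cO (compact_closure_bounded bO) cu0.
rewrite inE => cxm Hm.
pose d0 := u0 xm.
have d0_gt0 : 0 < d0 by exact: u0_gt0.
have [Bu Bu0 HBu] := sol_bound su T'T.
pose lam := Bc * Bu `^ (p - 1).
have Bc0 : 0 <= Bc.
  apply: le_trans (cB x0 0 _ _); [|exact: subset_closure|by rewrite lexx ltW].
  by apply: c_ge0 => //; exact: subset_closure.
have lam0 : 0 <= lam by rewrite mulr_ge0 // powR_ge0.
have key x t : closure Omega x -> 0 <= t <= T' -> d0 * expR (- lam * t) - u x t <= 0.
  apply: (@max_principle R n Omega nu oO bO sb hnu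
    (fun x t => d0 * expR (- lam * t) - u x t) T' 0 T'0) => //.
  - apply/subspace_continuousP => -[y s] Az.
    have /subspace_continuousP /(_ _ Az) cu := sol_continuous su T'T.
    apply: (fun h => cvgB h cu); apply: cvg_within_filter.
    have ce : {for s, continuous (fun r => expR (- lam * r))}.
      apply: differentiable_continuous; apply/derivable1_diffP.
      exact: (@ex_derive _ _ _ _ _ _ _ (is_derive_expRM (- lam) (is_derive_id s 1))).
    have cs : (fun z : 'rV[R]_n * R => z.2) @ (y, s) --> s by exact: cvg_snd.
    exact: (cvgM (cvg_cst d0) (cvg_comp _ _ cs ce)).
  - move=> y cy; rewrite mulr0 expR0 mulr1 subr_le0 (sol_initial su cy).
    by apply: Hm; rewrite inE.
  - move=> y s Oy /andP[s0 sT'] ws.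
    have sT : 0 < s < T by rewrite s0 (le_lt_trans sT').
    have cy : closure Omega y by exact: subset_closure.
    have [du d2u eu] := sol_derivatives su Oy sT.
    exists (d0 * (- lam * 1 * expR (- lam * s)) - partial_t u y s),
      (fun i => 0 - partial_x i (partial_x i u) y s); split.
    + apply: is_deriveB; apply: is_deriveZ.
      exact: (is_derive_expRM (- lam) (is_derive_id s 1)).
    + by move=> i; apply: deriv2_atB => //; exact: deriv2_at_cst.
    + rewrite sumrB big1 // eu.
      have uy0 : 0 <= u y s by apply: sol_ge0 su cy _; rewrite ltW //=; case/andP: sT.
      have sTl : 0 <= s <= T' by rewrite ltW.
      have h1 : c y s * u y s `^ p <= lam * (d0 * expR (- lam * s)).
        rewrite -(mulr_powRB1 uy0 p0) mulrCA mulrC /lam.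
        apply: ler_pM => //.
        * by rewrite mulr_ge0 ?powR_ge0 // c_ge0 // ltW.
        * apply: ler_pM => //; [by rewrite c_ge0 // ltW|exact: powR_ge0|exact: cB|].
          apply: ge0_ler_powR; rewrite ?nnegrE ?subr_ge0 //; first exact: ltW.
          exact: HBu.
        * by rewrite -subr_ge0 ltW.
      have -> : d0 * (- lam * 1 * expR (- lam * s)) = - (lam * (d0 * expR (- lam * s))) by ring.
      by rewrite opprB addrA lerD2r addrC subr_le0.
  - move=> y s M bz /andP[s0 sT'] ws HM.
    have sT : 0 <= s < T by rewrite ltW //= (le_lt_trans sT').
    have [_ _ _ nu' _] := su.
    exists (0 - integral_rV Omega (fun z => k y z s * u z s `^ l)).
      exact: (is_normal_derivativeB (is_normal_derivative_cst _ _ _) (nu' y s bz sT)).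
    by rewrite mul0r sub0r oppr_le0; exact: integral_kernel_ge0.
exists (d0 * expR (- lam * T')); first by rewrite mulr_gt0 // expR_gt0.
move=> x t cx tT'; have := key x t cx tT'; rewrite subr_le0; apply: le_trans.
by rewrite ler_pM2l // ler_expR !mulNr lerN2 ler_wpM2l //; case/andP: tT'.
Qed.

Lemma sol_eq (u v : 'rV[R]_n -> R -> R) : sol u -> sol v ->
  (forall T', 0 < T' < T -> exists2 d, 1 <= l \/ 0 < d &
     forall x t, closure Omega x -> 0 <= t <= T' -> d <= u x t) ->
  forall x t, closed_cylinder Omega T (x, t) -> v x t = u x t.
Proof.
move=> su sv H x t /(closed_cylinderE _ _ oO T0) [cx /andP[t0 tT]].
pose T' := (t + T) / 2.
have T'T : 0 < T' < T by rewrite /T'; apply/andP; split; lra.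
have tT' : 0 <= t <= T' by rewrite /T'; apply/andP; split; lra.
have [d ld hd] := H T' T'T.
apply/eqP; rewrite eq_le; apply/andP; split.
  apply: (sol_le su sv T'T ld _ cx tT') => y s cy sT.
  by rewrite le_max hd.
apply: (sol_le sv su T'T ld _ cx tT') => y s cy sT.
by rewrite le_max hd ?orbT.
Qed.

End uniqueness.

Lemma hoelder_bound (alpha : R) (D K : set ('rV[R]_n * R)) (c : 'rV[R]_n -> R -> R) :
  0 <= alpha -> loc_hoelder alpha D c -> compact K -> K `<=` D ->
  exists B, forall z, K z -> c z.1 z.2 <= B.
Proof.
move=> a0 hc cK KD.
have [[z0 Kz0]|K0] := pselect (K !=set0); last first.
  by exists 0 => z Kz; case: K0; exists z.
have [L HL] := hc K cK KD.
have [M [_ bM]] := compact_bounded cK.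
have bM1 z : K z -> `|z| <= `|M| + 1.
  by apply: bM; rewrite (le_lt_trans (ler_norm M)) // ltrDl.
exists (c z0.1 z0.2 + `|L| * (2 * (`|M| + 1)) `^ alpha) => z Kz.
rewrite -lerBlDl; apply: le_trans (ler_norm _) _; apply: le_trans (HL z z0 Kz Kz0) _.
apply: (@le_trans _ _ (`|L| * `|z - z0| `^ alpha)).
  by apply: ler_wpM2r; [exact: powR_ge0|exact: ler_norm].
have h : `|z - z0| <= 2 * (`|M| + 1).
  by rewrite mulr_natl mulr2n; apply: le_trans (ler_normB _ _) _; apply: lerD; exact: bM1.
by apply: ler_wpM2l => //; apply: (ge0_ler_powR a0 _ _ h); rewrite nnegrE ?(le_trans _ h) // normr_ge0.
Qed.
End solutions.

Theorem theorem3p4 (R : realType) (n : nat) (n_ge1 : (1 <= n)%N)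
  (Omega : set 'rV[R]_n) (hOmega : bounded_smooth_domain Omega)
  (nu : 'rV[R]_n -> 'rV[R]_n)
  (hnu : forall x, boundary Omega x -> unit_outward_normal Omega x (nu x))
  (p l : R) (p_gt0 : 0 < p) (l_gt0 : 0 < l)
  (alpha : R) (alpha_itv : 0 < alpha < 1)
  (c : 'rV[R]_n -> R -> R)
  (c_hoelder : loc_hoelder alpha (closure Omega `*` `[0, +oo[) c)
  (c_ge0 : forall x t, closure Omega x -> 0 <= t -> 0 <= c x t)
  (k : 'rV[R]_n -> 'rV[R]_n -> R -> R)
  (k_cont : {within boundary Omega `*` closure Omega `*` `[0, +oo[,
     continuous (fun z : 'rV[R]_n * 'rV[R]_n * R => k z.1.1 z.1.2 z.2)})
  (k_ge0 : forall x y t,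
     boundary Omega x -> closure Omega y -> 0 <= t -> 0 <= k x y t)
  (u0 : 'rV[R]_n -> R) (u0_C1 : C1_closure Omega u0)
  (u0_ge0 : forall x, Omega x -> 0 <= u0 x)
  (u0_compat : forall x, boundary Omega x ->
     is_normal_derivative u0 x (nu x)
       (integral_rV Omega (fun y => k x y 0 * u0 y `^ l)))
  (T : R) (T_gt0 : 0 < T)
  (cases :
     [\/ 1 <= l /\ (exists u, is_solution Omega nu p l c k u0 T u),
         [/\ l < 1, 1 <= p, (forall x, closure Omega x -> 0 < u0 x) &
             exists u, is_solution Omega nu p l c k u0 T u] |
         Num.max p l < 1 /\
         (exists u, is_solution Omega nu p l c k u0 T u /\
            forall x t, closed_cylinder Omega T (x, t) -> 0 < u x t)]) :
  exists u, is_solution Omega nu p l c k u0 T u /\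
    forall v, is_solution Omega nu p l c k u0 T v ->
      forall x t, closed_cylinder Omega T (x, t) -> v x t = u x t.
Proof.
have [oO _ [x0 Ox0] bO _] := hOmega.
have cx0 : closure Omega x0 by exact: subset_closure.
have cK (T' : R) : compact (closure Omega `*` `[0, T']).
  by apply: compact_setX; [exact: compact_closure_bounded|exact: segment_compact].
case: cases => [[l1 [u su]]|[_ p1 u0_gt0 [u su]]|[_ [u [su u_gt0]]]]; exists u; split => // v sv.
- apply: (sol_eq hOmega hnu p_gt0 l_gt0 T_gt0 c_ge0 k_cont k_ge0 su sv) => T' /andP[_ T'T].
  exists 0; first by left.
  move=> x t cx /andP[t0 tT']; apply: (sol_ge0 hOmega T_gt0 su cx).
  by rewrite t0 (le_lt_trans tT').
- apply: (sol_eq hOmega hnu p_gt0 l_gt0 T_gt0 c_ge0 k_cont k_ge0 su sv) => T' T'T.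
  have [alpha0 _] := andP alpha_itv.
  have [|Bc HBc] := hoelder_bound (ltW alpha0) c_hoelder (cK T').
    by move=> -[y s] [/= cy]; rewrite !in_itv /= => /andP[s0 _]; split => //=; rewrite ?in_itv /= ?s0.
  have [|d d0 hd] := sol_positive hOmega hnu p_gt0 T_gt0 c_ge0 k_ge0 u0_C1 (Bc := Bc) su T'T p1 u0_gt0.
    by move=> x t cx tT'; apply: (HBc (x, t)); split => //=; rewrite in_itv.
  by exists d; [right|].
- apply: (sol_eq hOmega hnu p_gt0 l_gt0 T_gt0 c_ge0 k_cont k_ge0 su sv) => T' /andP[T'0 T'T].
  have ne : closure Omega `*` `[0, T'] !=set0.
    by exists (x0, 0); split => //=; rewrite in_itv /= lexx ltW.
  have [[xm tm]] := compact_EVT_min ne (cK T') (sol_continuous hOmega T_gt0 su T'T).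
  rewrite inE => -[/= cxm]; rewrite in_itv /= => /andP[tm0 tmT'] Hm.
  exists (u xm tm).
    by right; apply: u_gt0; apply/closed_cylinderE => //; rewrite tm0 (le_lt_trans tmT').
  by move=> x t cx tT'; apply: (Hm (x, t)); rewrite inE; split => //=; rewrite in_itv.
Qed.
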